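(* If $G$ is a t.d.l.c.s.c. group that is $[A]$-regular, then $G\in\mathscr{E}$.
   Context: A t.d.l.c.s.c. group is a totally disconnected locally compact second countable (Hausdorff) topological group. The class $\mathscr{E}$ of elementary groups is the smallest class of t.d.l.c.s.c. groups such that: (i) $\mathscr{E}$ contains all second countable profinite groups and all countable discrete groups; (ii) if $G$ is a t.d.l.c.s.c. group and $H\trianglelefteq G$ is a closed normal subgroup with $H\in\mathscr{E}$ and $G/H$ either profinite or discrete, then $G\in\mathscr{E}$; (iii) if $G$ is a t.d.l.c.s.c. group and $G=\bigcup_{i\in\mathbb{N}}O_i$ where $(O_i)_{i\in\mathbb{N}}$ is an $\subseteq$-increasing sequence of open subgroups of $G$ with $O_i\in\mathscr{E}$ for each $i$, then $G\in\mathscr{E}$. All subgroups below are closed. Let $[A]$ be the smallest class of profinite groups such that: (i) $[A]$ contains all abelian profinite groups and all finite simple groups; (ii) if $U\in[A]$ and $K\trianglelefteq U$, then $K\in[A]$ and $U/K\in[A]$; (iii) if $U$ is a profinite group and $U=V_1\cdots V_n$ with $V_i\trianglelefteq U$ and $V_i\in[A]$ for each $1\leqslant i\leqslant n$, then $U\in[A]$. An $[A]$-subgroup is a subgroup belonging to $[A]$. A compact subgroup $K$ of a t.d.l.c. group $L$ is locally normal if its normalizer $N_L(K)$ is open in $L$. A t.d.l.c.s.c. group $G$ is $[A]$-regular if for every compact open subgroup $U$ of $G$ and every proper closed normal subgroup $L\trianglelefteq U$, the quotient $U/L$ contains a non-trivial locally normal $[A]$-subgroup of $U/L$. *)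

(* Defs.v *)
From HB Require Import structures.
From mathcomp Require Import all_boot.
From mathcomp Require Import all_classical.
From mathcomp Require Import topology.

Set Implicit Arguments.
Unset Strict Implicit.
Unset Printing Implicit Defensive.

Local Open Scope classical_set_scope.
Local Open Scope group_scope.
Local Open Scope quotient_scope.

HB.mixin Record PreTopologicalGroup_isTopologicalGroup G
    of Topological G & Group G := {
  mulg_continuous : continuous (fun x : G * G => x.1 * x.2) ;
  invg_continuous : continuous (fun x : G => x^-1)
}.

(* No separation axiom is part of the structure. *)
#[short(type="topologicalGroupType")]
HB.structure Definition TopologicalGroup :=
  {G of Topological G & Group G & PreTopologicalGroup_isTopologicalGroup G}.

(* Subgroups are not assumed closed; closedness is stated wherever it is
   required. *)
Record subgroup (G : groupType) := Subgroup {
  subgroup_set :> set G ;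
  subgroup1 : subgroup_set 1 ;
  subgroupM : forall x y, subgroup_set x -> subgroup_set y ->
    subgroup_set (x * y) ;
  subgroupV : forall x, subgroup_set x -> subgroup_set x^-1
}.

Record normal_subgroup (G : groupType) := NormalSubgroup {
  normal_subgroup_val :> subgroup G ;
  normal_subgroupJ : forall x g, subgroup_set normal_subgroup_val x ->
    subgroup_set normal_subgroup_val (x ^ g)
}.

(* The type of elements of H, as a topological group: [set_type H] already
   carries the subspace topology. *)
Section SubgroupType.
Context (G : topologicalGroupType) (H : subgroup G).

Lemma subgroup_group_closed : group_closed (fun x : G => x \in subgroup_set H).
Proof.
split=> [|x y]; first by apply/mem_set; exact: subgroup1.
rewrite unfold_in => /set_mem Hx; rewrite unfold_in => /set_mem Hy.
by apply/mem_set; apply: subgroupM => //; exact: subgroupV.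
Qed.

HB.instance Definition _ :=
  SubChoice.copy (set_type (subgroup_set H)) {x : G | x \in subgroup_set H}.
HB.instance Definition _ :=
  SubChoice_isSubGroup.Build G (fun x : G => x \in subgroup_set H)
    (set_type (subgroup_set H)) subgroup_group_closed.

Lemma set_type_continuous (T : topologicalType)
    (f : T -> set_type (subgroup_set H)) :
  continuous (fun x => \val (f x) : G) -> continuous f.
Proof.
move=> /continuousP cf; apply/continuousP => _ [B oB <-].
exact: (cf B oB).
Qed.

Let val_cont : continuous (\val : set_type (subgroup_set H) -> G).
Proof. exact: initial_continuous. Qed.

Lemma subgroup_mulg_continuous :
  continuous (fun x : set_type (subgroup_set H) * set_type (subgroup_set H) =>
    x.1 * x.2).
Proof.
apply: set_type_continuous => x /=.
apply: (@continuous_comp _ _ _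
  (fun z : set_type (subgroup_set H) * set_type (subgroup_set H) =>
     (\val z.1, \val z.2) : G * G) (fun z : G * G => z.1 * z.2));
  last exact: mulg_continuous.
apply: cvg_pair => /=.
  by apply: (continuous_comp (f := fst)); [exact: cvg_fst|exact: val_cont].
by apply: (continuous_comp (f := snd)); [exact: cvg_snd|exact: val_cont].
Qed.

Lemma subgroup_invg_continuous :
  continuous (fun x : set_type (subgroup_set H) => x^-1).
Proof.
apply: set_type_continuous => x /=.
apply: (@continuous_comp _ _ _ (\val : set_type (subgroup_set H) -> G)
  (fun z : G => z^-1)); [exact: val_cont|exact: invg_continuous].
Qed.

HB.instance Definition _ :=
  PreTopologicalGroup_isTopologicalGroup.Build (set_type (subgroup_set H))
    subgroup_mulg_continuous subgroup_invg_continuous.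

End SubgroupType.

Section Quotient.
Context (G : topologicalGroupType) (N : normal_subgroup G).

Definition coset_rel : rel G := fun x y => `[< subgroup_set N (x^-1 * y) >].

Lemma coset_rel_refl : reflexive coset_rel.
Proof. by move=> x; apply/asboolP; rewrite mulVg; exact: subgroup1. Qed.

Lemma coset_rel_sym : symmetric coset_rel.
Proof.
by move=> x y; apply/asboolP/asboolP => /subgroupV; rewrite invgM invgK.
Qed.

Lemma coset_rel_trans : transitive coset_rel.
Proof.
move=> y x z /asboolP xy /asboolP yz; apply/asboolP.
by have := subgroupM xy yz; rewrite mulgA mulgK.
Qed.

Canonical coset_equiv :=
  EquivRel coset_rel coset_rel_refl coset_rel_sym coset_rel_trans.

Definition quotg : Type := quotient_topology {eq_quot coset_equiv}.

HB.instance Definition _ :=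
  Topological.copy quotg (quotient_topology {eq_quot coset_equiv}).
HB.instance Definition _ :=
  Quotient.copy quotg (quotient_topology {eq_quot coset_equiv}).

Definition quotg_pi (x : G) : quotg := \pi_quotg x.

Lemma quotg_piP x y : quotg_pi x = quotg_pi y <-> subgroup_set N (x^-1 * y).
Proof.
split=> [/eqmodP/asboolP //|xy]; by apply/eqmodP/asboolP.
Qed.

Definition quotg_one : quotg := quotg_pi 1.
Definition quotg_inv (a : quotg) : quotg := quotg_pi (repr a)^-1.
Definition quotg_mul (a b : quotg) : quotg := quotg_pi (repr a * repr b).

Lemma quotg_reprK (a : quotg) : quotg_pi (repr a) = a.
Proof. exact: reprK. Qed.

Lemma quotg_piM x y : quotg_mul (quotg_pi x) (quotg_pi y) = quotg_pi (x * y).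
Proof.
have /quotg_piP Nx := quotg_reprK (quotg_pi x).
have /quotg_piP Ny := quotg_reprK (quotg_pi y).
apply/quotg_piP; set x' := repr _ in Nx *; set y' := repr _ in Ny *.
have -> : (x' * y')^-1 * (x * y) = (x'^-1 * x) ^ y' * (y'^-1 * y).
  by rewrite invgM /conjg !mulgA mulgK.
by apply: subgroupM => //; exact: normal_subgroupJ.
Qed.

Lemma quotg_piV x : quotg_inv (quotg_pi x) = quotg_pi x^-1.
Proof.
have /quotg_piP Nx := quotg_reprK (quotg_pi x).
apply/quotg_piP; set x' := repr _ in Nx *.
have -> : x'^-1^-1 * x^-1 = (x'^-1 * x)^-1 ^ x'^-1.
  by rewrite invgM !invgK /conjg invgK !mulgA mulgK.
by apply: normal_subgroupJ; exact: subgroupV.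
Qed.

Lemma quotg_mulA : associative quotg_mul.
Proof.
move=> a b c; rewrite -[a]quotg_reprK -[b]quotg_reprK -[c]quotg_reprK.
by rewrite !quotg_piM mulgA.
Qed.

Lemma quotg_mul1g : left_id quotg_one quotg_mul.
Proof. by move=> a; rewrite -[a]quotg_reprK quotg_piM mul1g. Qed.

Lemma quotg_mulg1 : right_id quotg_one quotg_mul.
Proof. by move=> a; rewrite -[a]quotg_reprK quotg_piM mulg1. Qed.

Lemma quotg_mulVg : left_inverse quotg_one quotg_inv quotg_mul.
Proof. by move=> a; rewrite -[a]quotg_reprK quotg_piV quotg_piM mulVg. Qed.

Lemma quotg_mulgV : right_inverse quotg_one quotg_inv quotg_mul.
Proof. by move=> a; rewrite -[a]quotg_reprK quotg_piV quotg_piM mulgV. Qed.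

HB.instance Definition _ := isGroup.Build quotg
  quotg_mulA quotg_mul1g quotg_mulg1 quotg_mulVg quotg_mulgV.

Lemma quotg_pi_continuous : continuous quotg_pi.
Proof. exact: pi_continuous. Qed.

Lemma mulg_continuousl (a : G) : continuous (fun x => x * a).
Proof.
move=> x; apply: (@continuous_comp _ _ _ (fun z : G => (z, a) : G * G)
  (fun z : G * G => z.1 * z.2)); last exact: mulg_continuous.
by apply: cvg_pair; [exact: cvg_id|exact: cvg_cst].
Qed.

Lemma quotg_pi_open (A : set G) : open A -> open (quotg_pi @` A).
Proof.
move=> oA; change (open (quotg_pi @^-1` (quotg_pi @` A))).
have -> : quotg_pi @^-1` (quotg_pi @` A) =
    \bigcup_(n in subgroup_set N) ((fun x => x * n) @^-1` A).
  apply/seteqP; split=> [x [y Ay /quotg_piP yx]|x [n Nn Axn]] /=.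
    exists (y^-1 * x)^-1; first exact: subgroupV.
    by rewrite /= invgM invgK mulgA mulgV mul1g.
  by exists (x * n) => //; apply/esym/quotg_piP; rewrite mulKg.
apply: bigcup_open => n _.
by move/continuousP: (@mulg_continuousl n); exact.
Qed.

Lemma quotg_pi_nbhs (x : G) (A : set G) : nbhs x A ->
  nbhs (quotg_pi x) (quotg_pi @` A).
Proof.
rewrite nbhsE => -[B [oB Bx] BA]; rewrite nbhsE.
exists (quotg_pi @` B); last exact: image_subset.
by split; [exact: quotg_pi_open|exists x].
Qed.

Lemma quotg_mulg_continuous : continuous (fun x : quotg * quotg => x.1 * x.2).
Proof.
move=> [a b] W /=; rewrite -[a]quotg_reprK -[b]quotg_reprK.
move: (repr a) (repr b) => x y.
rewrite [X in nbhs X _](_ : _ = quotg_pi (x * y)); last exact: quotg_piM.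
move=> /quotg_pi_continuous /(@mulg_continuous G (x, y)) [[A B] /= [nA nB] AB].
exists (quotg_pi @` A, quotg_pi @` B) => /=; first by split; exact: quotg_pi_nbhs.
move=> [_ _] /= [[x' Ax' <-] [y' By' <-]].
rewrite [X in W X](_ : _ = quotg_pi (x' * y')); last exact: quotg_piM.
exact: (AB (x', y')).
Qed.

Lemma quotg_invg_continuous : continuous (fun x : quotg => x^-1).
Proof.
move=> a W /=; rewrite -[a]quotg_reprK; move: (repr a) => x.
rewrite [X in nbhs X _](_ : _ = quotg_pi x^-1); last exact: quotg_piV.
move=> /quotg_pi_continuous /(@invg_continuous G x) /quotg_pi_nbhs.
apply: filterS => _ [x' /= Wx' <-].
by rewrite [X in W X](_ : _ = quotg_pi x'^-1) //; exact: quotg_piV.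
Qed.

HB.instance Definition _ :=
  PreTopologicalGroup_isTopologicalGroup.Build quotg
    quotg_mulg_continuous quotg_invg_continuous.

End Quotient.

Section TopologicalGroupPredicates.
Context (G : topologicalGroupType).

Definition subgroup_group (H : subgroup G) : topologicalGroupType :=
  set_type (subgroup_set H).

Definition quotient_group (N : normal_subgroup G) : topologicalGroupType :=
  quotg N.

Definition discrete_space : Prop := forall A : set G, open A.

Definition tdlcsc : Prop :=
  [/\ hausdorff_space G, totally_disconnected [set: G],
      locally_compact [set: G] & @second_countable G].

(* Profinite groups as the totally disconnected compact Hausdorff groups. *)
Definition profinite : Prop :=
  [/\ hausdorff_space G, totally_disconnected [set: G] & compact [set: G]].

Definition abelian_group : Prop := forall x y : G, x * y = y * x.

Definition simple_group : Prop :=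
  [set: G] <> [set 1] /\
  forall N : normal_subgroup G,
    subgroup_set N = [set 1] \/ subgroup_set N = [set: G].

Definition normalizer (K : subgroup G) : set G :=
  [set g | [set x ^ g | x in subgroup_set K] = subgroup_set K].

Definition locally_normal (K : subgroup G) : Prop :=
  compact (subgroup_set K) /\ open (normalizer K).

End TopologicalGroupPredicates.

Definition topgroup_iso (G H : topologicalGroupType) : Prop :=
  exists (f : G -> H) (g : H -> G),
    [/\ cancel f g, cancel g f, {morph f : x y / x * y},
        continuous f & continuous g].

(* As usual for classes of groups, "smallest class" means smallest
   isomorphism-closed class. *)
Inductive elementary : topologicalGroupType -> Prop :=
| elementary_profinite (G : topologicalGroupType) :
    profinite G -> @second_countable G -> elementary G
| elementary_discrete (G : topologicalGroupType) :
    discrete_space G -> countable [set: G] -> elementary G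
| elementary_extension (G : topologicalGroupType) (H : normal_subgroup G) :
    tdlcsc G -> closed (subgroup_set H) ->
    elementary (subgroup_group H) ->
    profinite (quotient_group H) \/ discrete_space (quotient_group H) ->
    elementary G
| elementary_union (G : topologicalGroupType) (O : nat -> subgroup G) :
    tdlcsc G -> (forall i, open (subgroup_set (O i))) ->
    (forall i, subgroup_set (O i) `<=` subgroup_set (O i.+1)) ->
    \bigcup_i subgroup_set (O i) = [set: G] ->
    (forall i, elementary (subgroup_group (O i))) ->
    elementary G
| elementary_iso (G H : topologicalGroupType) :
    topgroup_iso G H -> elementary G -> elementary H.

(* The class [A]. The topology of a finite profinite group is discrete, so the
   second constructor is about the finite simple groups. A product of [n]
   subgroups is the set of ordered products; [n = 0] only yields the trivial
   group. *)
Inductive classA : topologicalGroupType -> Prop :=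
| classA_abelian (U : topologicalGroupType) :
    profinite U -> abelian_group U -> classA U
| classA_simple (U : topologicalGroupType) :
    profinite U -> finite_set [set: U] -> simple_group U -> classA U
| classA_subgroup (U : topologicalGroupType) (K : normal_subgroup U) :
    classA U -> closed (subgroup_set K) -> classA (subgroup_group K)
| classA_quotient (U : topologicalGroupType) (K : normal_subgroup U) :
    classA U -> closed (subgroup_set K) -> classA (quotient_group K)
| classA_product (U : topologicalGroupType) (n : nat)
    (V : 'I_n -> normal_subgroup U) :
    profinite U -> (forall i, closed (subgroup_set (V i))) ->
    (forall u : U, exists2 v : 'I_n -> U,
      forall i, subgroup_set (V i) (v i) & u = \prod_(i < n) v i) ->
    (forall i, classA (subgroup_group (V i))) ->
    classA U
| classA_iso (U W : topologicalGroupType) :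
    topgroup_iso U W -> classA U -> classA W.

Definition A_regular (G : topologicalGroupType) : Prop :=
  forall U : subgroup G,
    compact (subgroup_set U) -> open (subgroup_set U) ->
    forall L : normal_subgroup (subgroup_group U),
      closed (subgroup_set L) -> subgroup_set L <> [set: subgroup_group U] ->
      exists K : subgroup (quotient_group L),
        [/\ closed (subgroup_set K), subgroup_set K <> [set 1],
            locally_normal K & classA (subgroup_group K)].

(* Main.v *)
(** Let R be a maximal closed normal elementary subgroup of G; it exists because the
closure of the union of a chain of such subgroups is elementary. Let V be a compact
open subgroup. If V is contained in R, then R is open and G is an extension of R by a
discrete group. Otherwise regularity, applied to the normal subgroup V ∩ R of V, gives
a closed subgroup K of V, not contained in R, with open normaliser and with K / (V ∩ R)
in [A]. Groups in [A] are solvable near 1: some iterated commutators of all elements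
close enough to 1 vanish. Finitely many conjugates of K have germs at 1 which normalise
each other, so these germs generate a solvable germ Y modulo R, and each conjugate
commutes with V modulo Y near 1. Induction on the solvability length of Y shows that V,
R and finitely many elements of conjugates of K generate an elementary group. By second
countability V, R and all conjugates of K do so too, and since closed subgroups of
elementary groups are elementary, the closed normal subgroup generated by R and K
contradicts the maximality of R. *)

From HB Require Import structures.
From mathcomp Require Import all_boot.
From mathcomp Require Import all_classical.
From mathcomp Require Import topology.
Require Import Defs.

Set Implicit Arguments.
Unset Strict Implicit.
Unset Printing Implicit Defensive.

Local Open Scope classical_set_scope.
Local Open Scope group_scope.

(* Lets a subgroup H be applied to an element, as in [H x]. *)
Identity Coercion set_funclass : set >-> Funclass.

(** * Topological groups: neighbourhoods of 1, generated subgroups, normalisers, closures *)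

Section TopologicalGroupBasics.
Context (G : topologicalGroupType).

Lemma cvg_mulg T (F : set_system T) {FF : Filter F} (f g : T -> G) (a b : G) :
  f @ F --> a -> g @ F --> b -> (fun x => f x * g x) @ F --> a * b.
Proof.
move=> fa gb; apply: (@continuous2_cvg _ _ _ _ F FF f g (fun x y => x * y) a b) => //.
exact: (@mulg_continuous G (a, b)).
Qed.

Lemma cvg_invg T (F : set_system T) {FF : Filter F} (f : T -> G) (a : G) :
  f @ F --> a -> (fun x => (f x)^-1) @ F --> a^-1.
Proof.
move=> fa; apply: (@continuous_cvg _ _ _ F FF f (fun x => x^-1) a) => //.
exact: invg_continuous.
Qed.

Lemma cvg_conjg T (F : set_system T) {FF : Filter F} (f g : T -> G) (a b : G) :
  f @ F --> a -> g @ F --> b -> (fun x => f x ^ g x) @ F --> a ^ b.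
Proof.
by move=> fa gb; apply: cvg_mulg; [exact: cvg_invg|exact: cvg_mulg].
Qed.

Lemma conjg_continuous (g : G) : continuous (fun x : G => x ^ g).
Proof. by move=> x; apply: cvg_conjg; [exact: cvg_id|exact: cvg_cst]. Qed.

Lemma near_conjg (g : G) (V : set G) :
  nbhs (1 : G) V -> nbhs (1 : G) [set x | V (x ^ g)].
Proof. by move=> V1; apply: (@conjg_continuous g); rewrite conj1g. Qed.

Lemma near_commg (g : G) (V : set G) :
  nbhs (1 : G) V -> nbhs (1 : G) [set x | V [~ x, g]].
Proof.
move=> V1; have h : (fun x : G => [~ x, g]) @ (1 : G) --> (1 : G).
  rewrite -[X in _ --> X](comm1g g); apply: cvg_mulg.
    by apply: cvg_invg; exact: cvg_id.
  exact: conjg_continuous.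
exact: h V1.
Qed.

Lemma near_translate (x : G) (V : set G) :
  nbhs (1 : G) V -> nbhs x [set y | V (x^-1 * y)].
Proof.
move=> V1; have h : (fun y : G => x^-1 * y) @ x --> (1 : G).
  by rewrite -[X in _ --> X](mulVg x); apply: cvg_mulg; [exact: cvg_cst|exact: cvg_id].
exact: h V1.
Qed.

Lemma near_invMg (V : set G) : nbhs (1 : G) V ->
  exists2 W, nbhs (1 : G) W & forall x y, W x -> W y -> V (x * y^-1).
Proof.
move=> V1; have h : (fun z : G * G => z.1 * z.2^-1) @ ((1, 1) : G * G) --> (1 : G).
  rewrite -[X in _ --> X](mulgV 1); apply: cvg_mulg; first exact: cvg_fst.
  by apply: cvg_invg; exact: cvg_snd.
have [[A B] /= [A1 B1] AB] := h _ V1.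
exists (A `&` B); first exact: filterI.
by move=> x y [Ax _] [_ By]; apply: (AB (x, y)).
Qed.

Lemma near_compact_conjg (C V : set G) : compact C -> nbhs (1 : G) V ->
  nbhs (1 : G) [set x | forall c, C c -> V (x ^ c)].
Proof.
move=> /compact_near_coveringP cC V1.
have := cC G (nbhs (1 : G)) (fun x c => V (x ^ c)) _ => /(_ _); apply.
move=> c Cc; have h : (fun z : G * G => z.2 ^ z.1) @ ((c, 1) : G * G) --> (1 : G).
  by rewrite -[X in _ --> X](conj1g c); apply: cvg_conjg; [exact: cvg_snd|exact: cvg_fst].
exact: h V1.
Qed.

Lemma open_subgroupP (H : subgroup G) : nbhs (1 : G) H -> open H.
Proof.
move=> H1; rewrite openE => x Hx; have := near_translate x H1.
apply: filterS => y /= Hy; have := subgroupM Hx Hy; by rewrite mulVKg.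
Qed.

Lemma nbhs_subgroup (H : subgroup G) : open H -> nbhs (1 : G) H.
Proof. by move=> oH; apply: open_nbhs_nbhs; split=> //; exact: subgroup1. Qed.

Lemma open_subgroup_closed (H : subgroup G) : open H -> closed H.
Proof.
move=> oH; rewrite -[X in closed X]setCK; apply: open_closedC.
rewrite openE => x nHx; have := near_translate x (nbhs_subgroup oH).
apply: filterS => y /= Hy Hy'; apply: nHx.
by have := subgroupM Hy' (subgroupV Hy); rewrite invgM invgK mulVKg.
Qed.

Lemma subgroup_conj (H : subgroup G) x y : H x -> H y -> H (x ^ y).
Proof. by move=> Hx Hy; apply: subgroupM; [exact: subgroupV|exact: subgroupM]. Qed.

Definition subgroupI (H K : subgroup G) : subgroup G.
Proof.
exists ((H : set G) `&` K).
- by split; exact: subgroup1.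
- by move=> x y [? ?] [? ?]; split; exact: subgroupM.
- by move=> x [? ?]; split; exact: subgroupV.
Defined.

Definition subgroup_bigI (P : subgroup G -> Prop) : subgroup G.
Proof.
exists [set x | forall H, P H -> H x] => /=.
- by move=> H _; exact: subgroup1.
- by move=> x y Hx Hy H PH; apply: subgroupM; [exact: Hx|exact: Hy].
- by move=> x Hx H PH; apply: subgroupV; exact: Hx.
Defined.

(** The abstract subgroup, with no closure taken. A member is a function on the subgroups containing
    [S], so induction on it means applying it to a tailor-made subgroup. *)
Definition gen (S : set G) := subgroup_bigI (fun H => S `<=` H).

Lemma sub_gen (S : set G) : S `<=` gen S.
Proof. by move=> x Sx H; apply. Qed.

Lemma gen_min (S : set G) (H : subgroup G) : S `<=` H -> gen S `<=` H.
Proof. by move=> SH x; apply. Qed.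

Lemma gen_sub (S T : set G) : S `<=` T -> gen S `<=` gen T.
Proof. by move=> ST; apply: gen_min; exact: subset_trans (@sub_gen T). Qed.

(** The setwise normaliser of an arbitrary set; the equivalence, in place of an inclusion, gives
    closure under inverses. *)
Definition nrm (S : set G) : subgroup G.
Proof.
exists [set g | forall x, S (x ^ g) <-> S x].
- by move=> x; rewrite conjg1.
- by move=> g h Sg Sh x; rewrite conjgM Sh Sg.
- by move=> g Sg x; rewrite -(Sg (x ^ g^-1)) conjgKV.
Defined.

Lemma nrmP (S : set G) g : (forall x, S x -> S (x ^ g)) ->
  (forall x, S x -> S (x ^ g^-1)) -> nrm S g.
Proof.
by move=> h h' x; split=> [/h'|/h //]; rewrite conjgK.
Qed.

Lemma sub_nrm (H S : set G) : (forall h, H h -> H h^-1) ->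
  (forall x h, S x -> H h -> S (x ^ h)) -> H `<=` nrm S.
Proof. by move=> HV SH h Hh; apply: nrmP => x Sx; apply: SH => //; exact: HV. Qed.

Lemma nrm_self (H : subgroup G) : H `<=` nrm H.
Proof. by apply: sub_nrm => [h|x h]; [exact: subgroupV|exact: subgroup_conj]. Qed.

Lemma nrmI (S T : set G) g : nrm S g -> nrm T g -> nrm (S `&` T) g.
Proof. by move=> Sg Tg x; split=> -[/Sg ? /Tg ?]. Qed.

Lemma nrm_gen (S : set G) : nrm S `<=` nrm (gen S).
Proof.
apply: sub_nrm => [|x g]; first exact: subgroupV.
move=> Sx /= Sg H SH; suff: nrm S `<=` (fun g => forall x, gen S x -> gen S (x ^ g)).
  by move=> h; apply: (h g Sg x Sx).
move=> {}g {}Sg {H SH} {}x {}Sx.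
(* Induction over [gen S]: [K] is the preimage of [gen S] under conjugation by [g], and it contains
   [S]. *)
pose K : subgroup G := {| subgroup_set := [set y | gen S (y ^ g)];
  subgroup1 := ltac:(by rewrite /mkset conj1g; exact: subgroup1);
  subgroupM := ltac:(by move=> u v; rewrite /mkset conjMg; exact: subgroupM);
  subgroupV := ltac:(by move=> u; rewrite /mkset conjVg; exact: subgroupV) |}.
apply: (Sx K) => y Sy /=; by apply: sub_gen; rewrite Sg.
Qed.

Lemma closure_mulg (A : set G) x y (B C : set G) :
  (forall a b, A a -> B b -> C (a * b)) -> closure A x -> closure B y ->
  closure C (x * y).
Proof.
move=> ABC Ax By V /(@mulg_continuous G (x, y)) [[P Q] /= [Px Qy] PQ].
have [a [Aa Pa]] := Ax _ Px; have [b [Bb Qb]] := By _ Qy.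
by exists (a * b); split; [exact: ABC|apply: (PQ (a, b))].
Qed.

Lemma closure_image (f : G -> G) (A B : set G) x : continuous f ->
  (forall a, A a -> B (f a)) -> closure A x -> closure B (f x).
Proof.
move=> cf AB Ax V /cf Vx; have [a [Aa Va]] := Ax _ Vx.
by exists (f a); split=> //; exact: AB.
Qed.

Definition closure_subgroup (H : subgroup G) : subgroup G.
Proof.
exists (closure H).
- by apply: subset_closure; exact: subgroup1.
- by move=> x y; apply: closure_mulg => a b; exact: subgroupM.
- move=> x; apply: (closure_image (f := fun x => x^-1)) => [|a].
    exact: invg_continuous.
  exact: subgroupV.
Defined.

Lemma nrm_closure (H : subgroup G) : nrm H `<=` nrm (closure_subgroup H).
Proof.
apply: sub_nrm => [|x g]; first exact: subgroupV.
move=> Hx Hg; apply: (closure_image (f := fun x => x ^ g)) Hx => [|a Ha].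
  exact: conjg_continuous.
by rewrite Hg.
Qed.

(** Since [W] normalises [N], [n w m v = (n m ^ w^-1) (w v)], so the products [n w] already form a
    subgroup. *)
Lemma gen_mulP (N W : subgroup G) : W `<=` nrm N ->
  forall x, gen ((N : set G) `|` W) x <-> exists n w, [/\ N n, W w & x = n * w].
Proof.
move=> WN x; split=> [|[n [w [Nn Ww ->]]]]; last first.
  by apply: subgroupM; apply: sub_gen; [left|right].
have WN' n w : W w -> N n -> N (n ^ w) by move=> /WN; rewrite /= => ->.
have P1 : [set z | exists n w, [/\ N n, W w & z = n * w]] 1.
  by exists 1, 1; split; rewrite ?mulg1 //; exact: subgroup1.
have PM a b : [set z | exists n w, [/\ N n, W w & z = n * w]] a ->
  [set z | exists n w, [/\ N n, W w & z = n * w]] b ->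
  [set z | exists n w, [/\ N n, W w & z = n * w]] (a * b).
  move=> [n [w [Nn Ww ->]]] [m [v [Nm Vv ->]]].
  exists (n * m ^ w^-1), (w * v); split.
  - by apply: subgroupM => //; apply: WN' => //; exact: subgroupV.
  - exact: subgroupM.
  - by rewrite conjgE !gnorm.
have PV a : [set z | exists n w, [/\ N n, W w & z = n * w]] a ->
  [set z | exists n w, [/\ N n, W w & z = n * w]] a^-1.
  move=> [n [w [Nn Ww ->]]]; exists (n^-1 ^ w), w^-1; split.
  - by apply: WN' => //; exact: subgroupV.
  - exact: subgroupV.
  - by rewrite conjgE !gnorm.
move/(_ {| subgroup1 := P1; subgroupM := PM; subgroupV := PV |}); apply => /= y [Ny|Wy].
  by exists y, 1; split; rewrite ?mulg1 //; exact: subgroup1.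
by exists 1, y; split; rewrite ?mul1g //; exact: subgroup1.
Qed.

End TopologicalGroupBasics.

Arguments gen : simpl never.
Arguments closure_subgroup : simpl never.
Arguments subgroupI : simpl never.

(** * Van Dantzig's theorem *)

Section VanDantzig.

(** If no [A] works, the sets of points of [K] and [A] outside [O] generate a proper filter; a
    cluster point in [K] lies in every closed [A] and outside the open [O], a contradiction. *)
Lemma compact_directed (T : topologicalType) (K O : set T)
    (P : set (set T)) :
  compact K -> open O -> P !=set0 ->
  (forall A B, P A -> P B -> exists2 C, P C & C `<=` A `&` B) ->
  (forall A, P A -> closed A) ->
  K `&` \bigcap_(A in P) A `<=` O -> exists2 A, P A & K `&` A `<=` O.
Proof.
move=> cK oO P0 PI Pc KO; apply: contrapT => H.
pose F := filter_from P (fun A => (K `&` A) `\` O).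
have FF : ProperFilter F.
  apply: filter_from_proper.
    apply: filter_from_filter => // A B PA PB; have [C PC CAB] := PI _ _ PA PB.
    exists C => // x [[Kx /CAB[Ax Bx]] nOx]; by split.
  move=> A PA; apply/set0P/eqP => A0; apply: H; exists A => // x KAx.
  apply: contrapT => nOx; suff: set0 x by [].
  by rewrite -A0.
have FK : F K by have [A PA] := P0; exists A => // x [[]].
have [x [Kx Fx]] := cK F FF FK.
have nOx : ~ O x.
  move=> Ox; have [A PA] := P0.
  have FA : F ((K `&` A) `\` O) by exists A.
  have [y [[_ nOy] Oy]] := Fx _ O FA (open_nbhs_nbhs (conj oO Ox)).
  exact: nOy.
apply: nOx; apply: KO; split=> // A PA; apply: Pc => // V Vx.
have FA : F ((K `&` A) `\` O) by exists A.
by have [y [[[_ Ay] _] Vy]] := Fx _ V FA Vx; exists y.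
Qed.

Context (G : topologicalGroupType).

Lemma compact_separated (A B : set G) : compact A -> closed B ->
  A `&` B = set0 -> exists2 W, nbhs (1 : G) W &
    forall a w, A a -> W w -> ~ B (a * w).
Proof.
move=> /compact_near_coveringP cA cB AB.
have : \forall w \near (1 : G), A `<=` (fun a => ~ B (a * w)).
  apply: (cA G (nbhs (1 : G)) (fun w a => ~ B (a * w))) => a Aa.
  have h : (fun z : G * G => z.1 * z.2) @ ((a, 1) : G * G) --> a.
    by rewrite -[X in _ --> X]mulg1; exact: (@mulg_continuous G (a, 1)).
  have nB : nbhs a (~` B).
    apply: open_nbhs_nbhs; split; first exact: closed_openC.
    move=> Ba; suff: set0 a by [].
    by rewrite -AB.
  exact: h nB.
by move=> hW; eexists; [exact: hW|move=> a w Aa; exact].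
Qed.

(** With [W' W'^-1] inside [W], translates [a W'] and [b W'] cannot meet: [a w = b w'] would put
    [a (w w'^-1) = b] in [B]. *)
Lemma compact_separated_opens (A B : set G) : compact A -> closed B ->
  A `&` B = set0 ->
  exists U V : set G, [/\ open U, open V, A `<=` U, B `<=` V & U `&` V = set0].
Proof.
move=> cA cB AB; have [W W1 hW] := compact_separated cA cB AB.
have [W' W'1 hW'] := near_invMg W1.
exists (\bigcup_(a in A) ((fun y => a^-1 * y) @^-1` W')°).
exists (\bigcup_(b in B) ((fun y => b^-1 * y) @^-1` W')°); split.
- by apply: bigcup_open => a _; exact: open_interior.
- by apply: bigcup_open => a _; exact: open_interior.
- by move=> a Aa; exists a => //; apply: near_translate.
- by move=> a Aa; exists a => //; apply: near_translate.
- rewrite -subset0 => x [[a Aa /nbhs_singleton /= ax] [b Bb /nbhs_singleton /= bx]].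
  apply: (hW a _ Aa (hW' _ _ ax bx)).
  by rewrite invgM invgK !mulgA mulgV mul1g mulgV mul1g.
Qed.

Hypothesis hG : hausdorff_space G.

(** In the compact set [K] the intersection [Q] of the relatively clopen sets containing 1 is
    connected, so it lies in the component of 1. A separation of [Q] would extend to disjoint open
    sets covering some relatively clopen [D], and one of the two pieces of [D] would contain [Q]. *)
Lemma quasicomponent (K : set G) : compact K -> K 1 ->
  connected_component K 1 = [set 1] ->
  \bigcap_(D in [set D : set G | [/\ closed D, closed (K `\` D), D `<=` K & D 1]]) D
  `<=` [set 1].
Proof.
move=> cK K1 <-; set P := [set D | _]; set Q := \bigcap_(D in P) D.
have clK : closed K by exact: compact_closed.
have PK : P K by split=> //; rewrite setDv; exact: closed0.
have QK : Q `<=` K by move=> x /(_ K PK).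
have cQ : closed Q by apply: closed_bigI => D [].
have Q1 : Q 1 by move=> D [].
apply: connected_component_max => // B B0 [C1 oC1 BC1] [C2 cC2 BC2].
have cB : closed B by rewrite BC2; exact: closedI.
have cB' : closed (Q `\` C1) by apply: closedI => //; exact: open_closedC.
have cptB : compact B.
  by apply: (subclosed_compact cB cK); rewrite BC2 => x [/QK].
have [U [V [oU oV BU BV UV]]] : exists U V : set G,
    [/\ open U, open V, B `<=` U, Q `\` C1 `<=` V & U `&` V = set0].
  apply: compact_separated_opens => //.
  by rewrite -subset0 BC1 => x [[_ C1x] [_ /(_ C1x)]].
have [D PD DUV] : exists2 D, P D & K `&` D `<=` U `|` V.
  apply: compact_directed => //.
  - exact: openU.
  - by exists K.
  - move=> D E [cD cKD DK D1] [cE cKE EK E1]; exists (D `&` E) => //; split.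
    + exact: closedI.
    + by rewrite setDIr; exact: closedU.
    + by move=> x [/DK].
    + by split.
  - by move=> D [].
  - move=> x [_ Qx]; have [C1x|C1x] := pselect (C1 x).
      by left; apply: BU; rewrite BC1.
    by right; apply: BV.
have [cD cKD DK D1] := PD.
(* Inside [D] the set [U1] is the complement of the open [V1]; hence [D] cut by [U1] is closed, and
   it is again relatively clopen in [K]. *)
have PU (U1 V1 : set G) : open U1 -> open V1 -> U1 `&` V1 = set0 ->
    K `&` D `<=` U1 `|` V1 -> U1 1 -> P (D `&` U1).
  move=> oU1 oV1 UV1 DUV1 U11; split.
  - have -> : D `&` U1 = D `&` ~` V1.
      apply/seteqP; split=> x [Dx].
        by move=> U1x; split=> // V1x; suff: set0 x by []; rewrite -UV1.
      by move=> nV1; split=> //; case: (DUV1 x (conj (DK _ Dx) Dx)).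
    by apply: closedI => //; exact: open_closedC.
  - rewrite setDIr; apply: closedU => //; apply: closedI => //; exact: open_closedC.
  - by move=> x [/DK].
  - by split.
have UV' x : U x -> V x -> False.
  by move=> Ux Vx; suff: set0 x by []; rewrite -UV.
have [U1|V1] := DUV 1 (conj K1 D1).
  have QU : Q `<=` U by move=> x /(_ _ (PU U V oU oV UV DUV U1)) [].
  rewrite BC1; apply/seteqP; split=> [x []//|x Qx]; split=> //.
  by apply: contrapT => nC1; exact: (UV' x (QU x Qx) (BV x (conj Qx nC1))).
exfalso; have [b Bb] := B0; apply: (UV' b); first exact: BU.
have Qb : Q b by move: Bb; rewrite BC2 => -[].
by have [] := Qb _ (PU V U oV oU _ _ V1); rewrite ?(setIC V) ?(setUC V).
Qed.

Hypothesis tG : totally_disconnected [set: G].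
Hypothesis lG : locally_compact [set: G].

Lemma locally_compact_near (x : G) : exists2 K, nbhs x K & compact K.
Proof.
have [K Kx [cK _]] := lG (I : [set: G] x).
exists K => //; have KT : \forall y \near x, [set: G] y -> K y by exact: Kx.
by apply: filterS KT => y; apply.
Qed.

(** By the description of the quasicomponent, 1 has a compact open neighbourhood [D] inside [V]. The
    subgroup is the stabiliser of [D] under right translation: open because [D] is compact and open,
    and inside [D] because [D] contains 1. *)
Theorem van_dantzig (V : set G) : nbhs (1 : G) V ->
  exists W : subgroup G, [/\ open W, compact W & W `<=` V].
Proof.
move=> V1; have [K K1 cK] := locally_compact_near 1.
have clK : closed K by exact: compact_closed.
have K11 : K 1 by exact: nbhs_singleton K1.
have KK : connected_component K 1 = [set 1].
  apply/seteqP; split=> [x [C [C1 CK cC] Cx]|_ ->]; last exact: connected_component_refl.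
  by rewrite -(tG (I : [set: G] 1)); exists C.
pose O := (K `&` V)°.
have oO : open O by exact: open_interior.
have O1 : O 1 by apply: filterI.
have [D [cD cKD DK D1] DO] : exists2 D,
   [set D : set G | [/\ closed D, closed (K `\` D), D `<=` K & D 1]] D & K `&` D `<=` O.
  apply: compact_directed => //.
  - by exists K; split=> //; rewrite setDv; exact: closed0.
  - move=> D E [cD cKD DK D1] [cE cKE EK E1]; exists (D `&` E) => //; split.
    + exact: closedI.
    + by rewrite setDIr; exact: closedU.
    + by move=> x [/DK].
    + by split.
  - by move=> D [].
  - by move=> x [_ /(quasicomponent cK K11 KK) ->].
(* [D] lies in the open set [O], itself inside [K], so it is [O] minus the closed set of points of
   [K] outside [D]. *)
have oD : open D.
  have -> : D = O `&` ~` (K `\` D).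
    apply/seteqP; split=> x; first by move=> Dx; split; [apply: DO; split=> //; exact: DK|case].
    move=> [/interior_subset[Kx _] nKD]; apply: contrapT => nD; exact: nKD.
  by apply: openI => //; exact: closed_openC.
have ctD : compact D by exact: (subclosed_compact cD cK DK).
have [Z Z1 hZ] : exists2 Z, nbhs (1 : G) Z & forall a w, D a -> Z w -> ~ ~ D (a * w).
  apply: (@compact_separated D (~` D)) => //; first exact: open_closedC.
  by rewrite setICr.
have [Y Y1 hY] := near_invMg Z1.
pose W : subgroup G := {| subgroup_set := [set g | forall x, D (x * g) <-> D x];
  subgroup1 := ltac:(by move=> x; rewrite mulg1);
  subgroupM := ltac:(by move=> g h Dg Dh x; rewrite mulgA Dh Dg);
  subgroupV := ltac:(by move=> g Dg x; rewrite -(Dg (x * g^-1)) mulgVK) |}.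
have WD : W `<=` D by move=> g /(_ 1); rewrite mul1g => ->.
have oW : open W.
  apply: open_subgroupP; have Y11 := nbhs_singleton Y1.
  apply: filterS Y1 => y Yy x; split=> Dx.
    rewrite -[x](mulgK y); apply: contrapT; apply: hZ => //.
    by rewrite -[y^-1]mul1g; exact: hY.
  apply: contrapT; apply: hZ => //.
  by rewrite -[y]mulg1 -[1]invg1; exact: hY.
exists W; split=> //.
  by apply: (subclosed_compact (open_subgroup_closed oW) cK); apply: subset_trans DK.
by move=> x /WD Dx; have /interior_subset[] := DO x (conj (DK _ Dx) Dx).
Qed.

End VanDantzig.

(** * Subgroups as topological groups *)

Section SubgroupGroup.
Context (G : topologicalGroupType).

Definition sub_val (H : subgroup G) (x : subgroup_group H) : G := \val x.

Definition sub_mk (H : subgroup G) (x : G) (Hx : H x) : subgroup_group H :=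
  exist _ x (mem_set Hx).

Lemma sub_mkK (H : subgroup G) x (Hx : H x) : sub_val (sub_mk Hx) = x.
Proof. by []. Qed.

Lemma sub_val_in (H : subgroup G) (x : subgroup_group H) : H (sub_val x).
Proof. exact: (set_mem (valP x)). Qed.

Lemma sub_val_inj (H : subgroup G) : injective (@sub_val H).
Proof. by move=> x y xy; apply: val_inj. Qed.

Lemma sub_valM (H : subgroup G) (x y : subgroup_group H) :
  sub_val (x * y) = sub_val x * sub_val y.
Proof. by []. Qed.

Lemma sub_valJ (H : subgroup G) (x y : subgroup_group H) :
  sub_val (x ^ y) = sub_val x ^ sub_val y.
Proof. by []. Qed.

Lemma sub_val_continuous (H : subgroup G) : continuous (@sub_val H).
Proof. exact: initial_continuous. Qed.

Lemma sub_val_nbhs (H : subgroup G) (x : subgroup_group H) A : nbhs x A ->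
  exists2 V, nbhs (sub_val x) V & @sub_val H @^-1` V `<=` A.
Proof.
rewrite nbhsE => -[B [[V oV VB] Bx] BA]; exists V.
  by apply: open_nbhs_nbhs; split=> //; move: Bx; rewrite -VB.
by move=> y Vy; apply: BA; rewrite -VB.
Qed.

Lemma sub_val_compact (H : subgroup G) (A : set (subgroup_group H)) :
  compact (@sub_val H @` A) -> compact A.
Proof.
move=> cA F FF FA; have FA' : (@sub_val H @ F) (@sub_val H @` A).
  by apply: (filterS (F := F) _ FA) => x Ax; exists x.
have [_ [[a Aa <-] aF]] := cA _ _ FA'.
exists a; split=> // P Q FP /sub_val_nbhs [V Va VQ].
have FP' : (@sub_val H @ F) (@sub_val H @` P).
  by apply: (filterS (F := F) _ FP) => x Px; exists x.
have [_ [[b Pb <-] Vb]] := aF _ _ FP' Va.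
by exists b; split=> //; apply: VQ.
Qed.

Lemma subgroup_compact (H : subgroup G) (C : set G) : closed H -> compact C ->
  compact (@sub_val H @^-1` C).
Proof.
move=> cH cC; apply: sub_val_compact.
suff -> : @sub_val H @` (@sub_val H @^-1` C) = C `&` H by exact: compact_closedI.
apply/seteqP; split=> [_ [x Cx <-]|x [Cx Hx]]; first by split=> //; exact: sub_val_in.
by exists (sub_mk Hx).
Qed.

Lemma hausdorff_injection (X Y : topologicalType) (f : X -> Y) :
  continuous f -> injective f -> hausdorff_space Y -> hausdorff_space X.
Proof.
move=> cf fI hY x y xy; apply: fI; apply: hY => A B /cf Ax /cf By.
by have [z [Az Bz]] := xy _ _ Ax By; exists (f z).
Qed.

Lemma totally_disconnected_injection (X Y : topologicalType) (f : X -> Y) :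
  continuous f -> injective f -> totally_disconnected [set: Y] ->
  totally_disconnected [set: X].
Proof.
move=> cf fI tY x _; apply/seteqP; split=> [y [C [Cx _ cC] Cy]|_ ->]; last first.
  exact: connected_component_refl.
apply: fI; have : connected_component [set: Y] (f x) (f y).
  exists (f @` C); last by exists y.
  split=> //.
  by apply: connected_continuous_connected => //; exact: continuous_subspaceT.
by rewrite tY.
Qed.

Lemma subgroup_second_countable (H : subgroup G) :
  @second_countable G -> @second_countable (subgroup_group H).
Proof.
move=> [B cB [oB nB]]; exists ((fun b => @sub_val H @^-1` b) @` B).
  by apply: card_le_trans cB; exact: card_image_le.
split=> [_ [b Bb <-]|x V].
  by apply: open_comp (oB _ Bb) => x _; exact: sub_val_continuous.
move=> /sub_val_nbhs [U Ux UV].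
have [b [Bb bx] bU] := nB _ _ Ux.
exists (@sub_val H @^-1` b); first by split=> //; exists b.
by apply: subset_trans UV => y /bU.
Qed.

Lemma subgroup_tdlcsc (H : subgroup G) : tdlcsc G -> closed H ->
  tdlcsc (subgroup_group H).
Proof.
move=> [hG tG lG sG] cH; split.
- exact: hausdorff_injection (@sub_val_continuous H) (@sub_val_inj H) hG.
- exact: totally_disconnected_injection (@sub_val_continuous H) (@sub_val_inj H) tG.
- move=> x _; have [K Kx cK] := locally_compact_near lG (sub_val x).
  have cK' := subgroup_compact cH cK; exists (@sub_val H @^-1` K).
    have Kx' : nbhs x (@sub_val H @^-1` K) by exact: sub_val_continuous Kx.
    change (\forall y \near x, [set: subgroup_group H] y -> K (sub_val y)).
    by apply: filterS Kx' => y Ky _.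
  split=> //; apply: compact_closed cK'.
  exact: hausdorff_injection (@sub_val_continuous H) (@sub_val_inj H) hG.
- exact: subgroup_second_countable.
Qed.

(** The last hypothesis says that [f] induces the topology of [X], whence the continuity of the
    inverse. *)
Lemma topgroup_iso_sub (X : topologicalGroupType) (H : subgroup G) (f : X -> G) :
  injective f -> {morph f : x y / x * y} -> continuous f ->
  (forall x, H (f x)) -> (forall h, H h -> exists x, f x = h) ->
  (forall x V, nbhs x V -> exists2 V', nbhs (f x) V' & f @^-1` V' `<=` V) ->
  topgroup_iso X (subgroup_group H).
Proof.
move=> fI fM cf Hf fH fV.
have /choice [g gK] : forall h : subgroup_group H, exists x, f x = sub_val h.
  by move=> h; apply: fH; exact: sub_val_in.
exists (fun x => sub_mk (Hf x)), g; split.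
- by move=> x; apply: fI; rewrite gK.
- by move=> h; apply: sub_val_inj; rewrite sub_mkK gK.
- by move=> x y; apply: sub_val_inj; rewrite sub_valM !sub_mkK fM.
- by apply: set_type_continuous => x; exact: cf.
- move=> h V /fV [V']; rewrite gK => V'h V'V.
  have V'h' : nbhs h (@sub_val H @^-1` V') by exact: sub_val_continuous V'h.
  change (nbhs h (g @^-1` V)).
  by apply: filterS V'h' => y V'y; apply: V'V; rewrite /= gK.
Qed.

End SubgroupGroup.

Section SubgroupOfSubgroup.
Context (G : topologicalGroupType).

Definition sub_in (K H : subgroup G) : subgroup (subgroup_group K).
Proof.
exists (@sub_val G K @^-1` H) => /=.
- exact: subgroup1.
- by move=> x y; exact: subgroupM.
- by move=> x; exact: subgroupV.
Defined.

Lemma sub_in_iso (K H : subgroup G) : H `<=` K ->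
  topgroup_iso (subgroup_group (sub_in K H)) (subgroup_group H).
Proof.
move=> HK; apply: (@topgroup_iso_sub G (subgroup_group (sub_in K H)) H
  (fun x => sub_val (sub_val x : subgroup_group K))) => //.
- by move=> x y /sub_val_inj /sub_val_inj.
- by move=> x; apply: continuous_comp; exact: sub_val_continuous.
- by move=> x; exact: (sub_val_in x).
- by move=> h Hh; exists (@sub_mk _ (sub_in K H) (sub_mk (HK _ Hh)) Hh).
- move=> x V /sub_val_nbhs [V1 /sub_val_nbhs [V2 V2x V21] V1V].
  by exists V2 => // y /V21 /V1V.
Qed.

End SubgroupOfSubgroup.

Lemma topgroup_iso_sym (G H : topologicalGroupType) :
  topgroup_iso G H -> topgroup_iso H G.
Proof.
move=> [f [g [fK gK fM cf cg]]]; exists g, f; split=> //.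
by move=> x y; rewrite -{1}[x]gK -{1}[y]gK -fM fK.
Qed.

(** * Discrete and profinite quotients *)

Section Quotients.
Context (G : topologicalGroupType) (N : normal_subgroup G).

Lemma quotg_openP (A : set (quotient_group N)) :
  open A <-> open (@quotg_pi G N @^-1` A).
Proof. by []. Qed.

Lemma quotg_surj (a : quotient_group N) : exists x : G, quotg_pi N x = a.
Proof. by exists (repr a); exact: quotg_reprK. Qed.

Lemma nrm_normal : [set: G] `<=` nrm N.
Proof. by apply: sub_nrm => // x g Nx _; exact: normal_subgroupJ. Qed.

Lemma quotg_discrete : open (N : set G) -> discrete_space (quotient_group N).
Proof.
move=> oN A; apply/quotg_openP; rewrite openE => x Ax.
have := near_translate x (nbhs_subgroup oN); apply: filterS => y Nxy.
by rewrite /= -(_ : quotg_pi N x = quotg_pi N y) //; apply/quotg_piP.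
Qed.

(** If [x N] and [y N] differ, some compact open subgroup [W] has [x^-1 y] outside [N W]. This is an
    open subgroup because [N] is normal, and its coset through [x] gives a clopen set separating the
    two points. Compactness comes from the image of [C]. *)
Lemma quotg_profinite (C : set G) : tdlcsc G -> closed (N : set G) ->
  compact C -> (forall x, exists n c, [/\ N n, C c & x = n * c]) ->
  profinite (quotient_group N).
Proof.
move=> [hG tG lG sG] cN cC NC.
have sep (a b : quotient_group N) : a != b ->
    exists U : set (quotient_group N), [/\ clopen U, U a & ~ U b].
  have [x <-] := quotg_surj a; have [y <-] := quotg_surj b => xy.
  have nN : ~ N (x^-1 * y) by move=> /quotg_piP E; rewrite E eqxx in xy.
  have h : (fun w : G => w^-1 * (x^-1 * y)) @ (1 : G) --> x^-1 * y.
    rewrite -[X in _ --> X]mul1g -[X in _ --> X * _]invg1; apply: cvg_mulg.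
      by apply: cvg_invg; exact: cvg_id.
    exact: cvg_cst.
  have nV : nbhs (x^-1 * y) (~` (N : set G)).
    by apply: open_nbhs_nbhs; split=> //; exact: closed_openC.
  have [W [oW cW WV]] := van_dantzig hG tG lG (h _ nV).
  pose M := gen ((N : set G) `|` W).
  have MP := gen_mulP (subset_trans (@subsetT _ _) nrm_normal : (W : set G) `<=` nrm N).
  have oM : open M.
    apply: open_subgroupP; apply: filterS (nbhs_subgroup oW) => w Ww.
    by apply: sub_gen; right.
  have NM : N `<=` M by move=> n Nn; apply: sub_gen; left.
  have cM := open_subgroup_closed oM.
  pose U : set (quotient_group N) := [set c | exists2 z, quotg_pi N z = c & M (x^-1 * z)].
  have UE : @quotg_pi G N @^-1` U = (fun z => x^-1 * z) @^-1` M.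
    apply/seteqP; split=> z; last by exists z.
    move=> [z' /quotg_piP /NM z'z Mz']; rewrite /=.
    have -> : x^-1 * z = (x^-1 * z') * (z'^-1 * z) by rewrite mulgA mulgK.
    refine (@subgroupM _ M _ _ Mz' z'z).
  have cl : continuous (fun z : G => x^-1 * z).
    by move=> z; apply: cvg_mulg; [exact: cvg_cst|exact: cvg_id].
  exists U; split.
  - split; first by apply/quotg_openP; rewrite UE; apply: open_comp.
    rewrite -[U]setCK; apply: open_closedC; apply/quotg_openP.
    rewrite -preimage_setC UE preimage_setC; apply: open_comp => //.
    exact: closed_openC.
  - by exists x => //; rewrite mulVg; exact: subgroup1.
  - move=> Uy; have : (@quotg_pi G N @^-1` U) y by [].
    rewrite UE /= => /MP [n [w [Nn Ww E]]].
    by apply: (WV _ Ww); rewrite E; exact: (normal_subgroupJ w Nn).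
split.
- move=> a b ab; apply: contrapT => /eqP /sep [U [[oU cU] Ua nUb]].
  have Ua' : nbhs a U by apply: open_nbhs_nbhs.
  have Ub' : nbhs b (~` U) by apply: open_nbhs_nbhs; split=> //; exact: closed_openC.
  by have [c [Uc nUc]] := ab _ _ Ua' Ub'.
- exact: zero_dimension_totally_disconnected.
- have -> : [set: quotient_group N] = @quotg_pi G N @` C.
    apply/seteqP; split=> // a _; have [x <-] := quotg_surj a.
    have [n [c [Nn Cc ->]]] := NC x; exists c => //; apply/quotg_piP.
    by have := normal_subgroupJ c Nn; rewrite conjgE.
  apply: continuous_compact => //; apply: continuous_subspaceT.
  exact: quotg_pi_continuous.
Qed.

End Quotients.

(** * Elementary subgroups: extensions and countable unions *)

Definition elem (G : topologicalGroupType) (H : subgroup G) :=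
  elementary (subgroup_group H).

Section Extensions.
Context (G : topologicalGroupType).
Hypothesis tG : tdlcsc G.

Definition normal_sub_in (O N : subgroup G) (ON : O `<=` nrm N) :
  normal_subgroup (subgroup_group O).
Proof.
exists (sub_in O N) => x g Nx.
change (N (sub_val x ^ sub_val g)); apply/(ON _ (sub_val_in g)); exact: Nx.
Defined.

(** The quotient is the image of the compact set [C] cut down to [O], hence profinite. *)
Lemma elem_extension_compact (N O : subgroup G) (C : set G) :
  closed O -> closed N -> N `<=` O -> O `<=` nrm N -> elem N -> compact C ->
  (forall x, O x -> exists n c, [/\ N n, C c & x = n * c]) -> elem O.
Proof.
move=> cO cN NO ON eN cC NC.
have cN' : closed (sub_in O N : set (subgroup_group O)).
  apply: preimage_closed => // x _; exact: sub_val_continuous.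
apply: (@elementary_extension (subgroup_group O) (normal_sub_in ON)) => //.
- exact: subgroup_tdlcsc.
- apply: elementary_iso eN; apply: topgroup_iso_sym; exact: sub_in_iso.
- left; apply: (@quotg_profinite _ _ (@sub_val G O @^-1` C)) => //.
  + exact: subgroup_tdlcsc.
  + exact: subgroup_compact.
  + move=> x; have [n [c [Nn Cc E]]] := NC _ (sub_val_in x).
    have Oc : O c.
      have := subgroupM (subgroupV (NO _ Nn)) (sub_val_in x).
      by rewrite E mulKg.
    by exists (sub_mk (NO _ Nn)), (sub_mk Oc); split=> //; exact: sub_val_inj.
Qed.

Lemma elem_extension_open (N O : subgroup G) :
  open (N : set G) -> open (O : set G) -> N `<=` O -> O `<=` nrm N -> elem N -> elem O.
Proof.
move=> oN oO NO ON eN.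
have cN' : closed (sub_in O N : set (subgroup_group O)).
  apply: preimage_closed; last exact: open_subgroup_closed.
  move=> x _; exact: sub_val_continuous.
apply: (@elementary_extension (subgroup_group O) (normal_sub_in ON)) => //.
- by apply: subgroup_tdlcsc => //; exact: open_subgroup_closed.
- apply: elementary_iso eN; apply: topgroup_iso_sym; exact: sub_in_iso.
- right; apply: quotg_discrete; apply: open_comp => // x _; exact: sub_val_continuous.
Qed.

(** One point is chosen in each non-empty set of a countable base; every coset [W x] is open, so it
    contains one of these points. *)
Lemma countable_translates (W : subgroup G) : open (W : set G) ->
  exists d : nat -> G, forall x, exists n, W (x * (d n)^-1).
Proof.
move=> oW; have [_ _ _ [B /countable_injP[f fI] [oB nB]]] := tG.
have /choice [d dP] : forall n : nat, exists d : G, forall b, B b -> f b = n ->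
    b !=set0 -> b d.
  move=> n; have [[b [Bb bn [x bx]]]|H] :=
    pselect (exists b, [/\ B b, f b = n & b !=set0]).
    exists x => b' Bb' b'n _; suff -> : b' = b by [].
    by apply: fI; rewrite ?inE // b'n bn.
  (* Numbers that code no non-empty basic set get the default point 1. *)
  by exists 1 => b Bb bn b0; exfalso; apply: H; exists b.
exists d => x.
have h : (fun y : G => x * y^-1) @ x --> (1 : G).
  rewrite -[X in _ --> X](mulgV x); apply: cvg_mulg; first exact: cvg_cst.
  by apply: cvg_invg; exact: cvg_id.
have [b [Bb bx] bW] := nB _ _ (h _ (nbhs_subgroup oW)).
by exists (f b); apply: bW; apply: dP => //; exists x.
Qed.

Definition finite_sub (s : seq G) (S : set G) := forall x, x \in s -> S x.

Lemma gen_finite_support (B S : set G) x : gen (B `|` S) x ->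
  exists2 s, finite_sub s S & gen (B `|` [set` s]) x.
Proof.
pose P := [set x | exists2 s, finite_sub s S & gen (B `|` [set` s]) x].
have cat_sub (s t : seq G) : [set` s] `<=` [set` s ++ t] /\ [set` t] `<=` [set` s ++ t].
  by split=> z /= zs; rewrite mem_cat zs ?orbT.
have P1 : P 1 by exists [::] => //; exact: subgroup1.
have PM a b : P a -> P b -> P (a * b).
  move=> [s sS sa] [t tS tb]; exists (s ++ t).
    by move=> z; rewrite mem_cat => /orP[/sS|/tS].
  have [h1 h2] := cat_sub s t.
  apply: subgroupM; [apply: gen_sub sa|apply: gen_sub tb]; exact: setUS.
have PV a : P a -> P a^-1.
  by move=> [s sS sa]; exists s => //; exact: subgroupV.
move/(_ {| subgroup1 := P1; subgroupM := PM; subgroupV := PV |}); apply => z [Bz|Sz].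
  by exists [::] => //; apply: sub_gen; left.
exists [:: z]; first by move=> y; rewrite inE => /eqP ->.
by apply: sub_gen; right; rewrite /= inE.
Qed.

Lemma gen_open (B : set G) (W : subgroup G) : open (W : set G) -> W `<=` B ->
  open (gen B : set G).
Proof.
move=> oW WB; apply: open_subgroupP; apply: filterS (nbhs_subgroup oW) => w Ww.
by apply: sub_gen; exact: WB.
Qed.

(** Countably many points [d n] represent all cosets of [W], and each [d n] in [O] needs only
    finitely many generators from [S]. So [O] is an increasing union of open subgroups generated by
    [B] and finite parts of [S]. *)
Lemma elem_gen_finite (W : subgroup G) (B S : set G) :
  open (W : set G) -> W `<=` B ->
  (forall s, finite_sub s S -> elem (gen (B `|` [set` s]))) ->
  elem (gen (B `|` S)).
Proof.
move=> oW WB H; set O := gen (B `|` S).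
have oO : open (O : set G) by apply: gen_open oW _; exact: subset_trans (@subsetUl _ _ _).
have [d dP] := countable_translates oW.
have /choice [l lP] : forall n, exists s : seq G, finite_sub s S /\
    (O (d n) -> gen (B `|` [set` s]) (d n)).
  move=> n; have [Od|nO] := pselect (O (d n)); last by exists [::].
  by have [s sS sd] := gen_finite_support Od; exists s.
(* [L n] collects the generators needed by [d m] for [m < n], so [d n] is reached in [On n.+1]. *)
pose L := fix L n := if n is m.+1 then l m ++ L m else [::].
have LS n : finite_sub (L n) S.
  elim: n => //= n IH x; rewrite mem_cat => /orP[]; last exact: IH.
  by have [h _] := lP n; exact: h.
pose On n := gen (B `|` [set` L n]).
have OnO n : On n `<=` O.
  by apply: gen_sub; apply: setUS => x /LS.
apply: (@elementary_union (subgroup_group O) (fun n => sub_in O (On n))).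
- by apply: subgroup_tdlcsc => //; exact: open_subgroup_closed.
- move=> n; apply: open_comp => [x _|]; first exact: sub_val_continuous.
  by apply: gen_open oW _; exact: subset_trans (@subsetUl _ _ _).
- move=> n x; apply: gen_sub; apply: setUS => y /= yL.
  by rewrite mem_cat yL orbT.
- apply/seteqP; split=> // x _; have [n Wx] := dP (sub_val x).
  have Ox := sub_val_in x.
  have Od : O (d n).
    rewrite -[d n](mulKg (sub_val x * (d n)^-1)).
    rewrite mulgVK; apply: subgroupM => //; apply: subgroupV.
    by apply: sub_gen; left; exact: WB.
  exists n.+1 => //; change (On n.+1 (sub_val x)).
  rewrite -[sub_val x](mulgVK (d n)); apply: subgroupM.
    by apply: sub_gen; left; exact: WB.
  have [_ /(_ Od)] := lP n; apply: gen_sub; apply: setUS => y /= yl.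
  by rewrite mem_cat yl.
- move=> n; apply: elementary_iso (H _ (LS n)); apply: topgroup_iso_sym.
  exact: sub_in_iso.
Qed.

End Extensions.

(** * Morphisms, and small open subgroups normalised by a compact subgroup *)

Lemma morph_group1 (X Y : groupType) (f : X -> Y) :
  {morph f : x y / x * y} -> f 1 = 1.
Proof. by move=> fM; apply: (mulgI (f 1)); rewrite -fM !mulg1. Qed.

Lemma morph_groupV (X Y : groupType) (f : X -> Y) :
  {morph f : x y / x * y} -> {morph f : x / x^-1}.
Proof.
move=> fM x; apply: (mulgI (f x)).
by rewrite -fM !mulgV morph_group1.
Qed.

Lemma morph_groupJ (X Y : groupType) (f : X -> Y) :
  {morph f : x y / x * y} -> {morph f : x y / x ^ y}.
Proof. by move=> fM x y; rewrite !conjgE !fM morph_groupV. Qed.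

Lemma morph_groupR (X Y : groupType) (f : X -> Y) :
  {morph f : x y / x * y} -> {morph f : x y / [~ x, y]}.
Proof. by move=> fM x y; rewrite fM (morph_groupV fM) (morph_groupJ fM). Qed.

Lemma filter_seq (T : Type) (I : eqType) (F : set_system T) (s : seq I)
    (P : I -> T -> Prop) : Filter F ->
  (forall i, i \in s -> F (P i)) -> F [set x | forall i, i \in s -> P i x].
Proof.
move=> FF; elim: s => [|i s IH] H.
  by apply: filterS filterT => x _ i; rewrite in_nil.
have Hi : F (P i) by apply: H; rewrite inE eqxx.
have Hs : F [set x | forall i, i \in s -> P i x].
  by apply: IH => j js; apply: H; rewrite inE js orbT.
apply: filterS2 Hi Hs => x Pi Ps j; by rewrite inE => /orP[/eqP ->|/Ps].
Qed.

Section Core.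
Context (G : topologicalGroupType).
Hypothesis hG : hausdorff_space G.
Hypothesis dG : totally_disconnected [set: G].
Hypothesis lG : locally_compact [set: G].

(** Intersecting the conjugates of a small open [W] by [C] gives an invariant subgroup, which stays
    open because [C] is compact. *)
Lemma near_normal_core (C : subgroup G) (V : set G) :
  compact (C : set G) -> nbhs (1 : G) V ->
  exists M : subgroup G, [/\ open (M : set G), M `<=` V & C `<=` nrm M].
Proof.
move=> cC V1; have [W [oW cW WV]] := van_dantzig hG dG lG V1.
exists {| subgroup_set := [set x | forall c, C c -> W (x ^ c)];
  subgroup1 := ltac:(by move=> c _; rewrite conj1g; exact: subgroup1);
  subgroupM := ltac:(by move=> x y Wx Wy c Cc; rewrite conjMg; apply: subgroupM; auto);
  subgroupV := ltac:(by move=> x Wx c Cc; rewrite conjVg; apply: subgroupV; auto) |}.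
split.
- apply: open_subgroupP; apply: near_compact_conjg => //; exact: nbhs_subgroup.
- move=> x /= /(_ 1 (subgroup1 C)); rewrite conjg1; exact: WV.
- apply: sub_nrm => [|x h /= Wx Ch c Cc]; first exact: subgroupV.
  by rewrite -conjgM; apply: Wx; exact: subgroupM.
Qed.

End Core.

Lemma elem_full (G : topologicalGroupType) (H : subgroup G) :
  (forall x, H x) -> elem H -> elementary G.
Proof.
move=> HT; apply: elementary_iso; exists (@sub_val G H), (fun x => sub_mk (HT x)).
split=> //.
- by move=> x; apply: sub_val_inj.
- exact: sub_val_continuous.
- by apply: set_type_continuous => x; exact: cvg_id.
Qed.

Lemma profinite_locally_compact (P : topologicalGroupType) :
  profinite P -> locally_compact [set: P].
Proof.
move=> [_ _ cP] x _; exists [set: P].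
  change (\forall y \near x, [set: P] y -> [set: P] y).
  by apply: nearW.
by split=> //; exact: closedT.
Qed.

(** * Kernels, and closed subgroups of elementary groups *)

Section Kernel.
Context (X P : topologicalGroupType) (phi : X -> P) (K : subgroup X).
Hypothesis tX : tdlcsc X.
Hypothesis phiM : {morph phi : x y / x * y}.
Hypothesis phi_cont : continuous phi.
Hypothesis KP : forall x, K x <-> phi x = 1.
Hypothesis eK : elem K.

Lemma kernel_normal : [set: X] `<=` nrm K.
Proof.
apply: sub_nrm => // x g /KP px _; apply/KP.
by rewrite (morph_groupJ phiM) px conj1g.
Qed.

Lemma elem_kernel_discrete : discrete_space P -> elementary X.
Proof.
move=> dP; have oK : open (K : set X).
  have -> : K = phi @^-1` [set 1] :> set X by apply/seteqP; split=> x /KP.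
  by apply: open_comp => // x _; exact: phi_cont.
apply: (@elem_full X (gen [set: X])) => [x|]; first exact: sub_gen.
apply: (elem_extension_open tX oK) => //.
- by apply: (@gen_open _ _ K oK).
- by move=> x _; apply: sub_gen.
- by move=> x _; exact: kernel_normal.
Qed.

(* Inside the group generated by K, a compact open subgroup W and finitely many
   elements, the preimage of a small open normal subgroup of P meets W K in an
   open normal subgroup which is compact modulo K. *)
Lemma elem_kernel_profinite : profinite P -> elementary X.
Proof.
move=> pP; have [hP dP cP] := pP; have lP := profinite_locally_compact pP.
have [hX dX lX sX] := tX.
have [W [oW cW _]] := van_dantzig hX dX lX (@filterT _ _ (nbhs_filter (1 : X))).
apply: (@elem_full X (gen ((W `|` K) `|` [set: X]))) => [x|].
  by apply: sub_gen; right.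
apply: (elem_gen_finite tX oW) => [|s _]; first exact: subsetUl.
have nWK : W `<=` nrm K by move=> x _; exact: kernel_normal.
pose WK := gen ((K : set X) `|` W); have WKP := gen_mulP nWK.
have KWK : K `<=` WK by move=> x Kx; apply: sub_gen; left.
have WWK : W `<=` WK by move=> x Wx; apply: sub_gen; right.
have oWK : open (WK : set X) by apply: gen_open oW _; exact: subsetUr.
pose O := [set x | forall f, f \in s -> WK (x ^ f) /\ WK (x ^ f^-1)].
have oO : open O.
  rewrite openE => x Ox; apply: filter_seq => f fs; have [O1 O2] := Ox f fs.
  apply: filterI.
    exact: (conjg_continuous (open_nbhs_nbhs (conj oWK O1))).
  exact: (conjg_continuous (open_nbhs_nbhs (conj oWK O2))).
pose Q (A : set X) := exists2 M : subgroup P, open (M : set P) /\ [set: P] `<=` nrm M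
   & A = phi @^-1` M.
have [A [M [oM nM] ->] MO] : exists2 A, Q A & W `&` A `<=` O.
  apply: compact_directed => //.
  - have := near_normal_core hP dP lP (C := gen [set: P]) _ (@filterT _ _ (nbhs_filter (1 : P))).
    have -> : (gen [set: P] : set P) = [set: P].
      by apply/seteqP; split=> // x _; exact: sub_gen.
    by move=> /(_ cP) [M [oM _ nM]]; exists (phi @^-1` M), M.
  - move=> _ _ [M [oM nM] ->] [M' [oM' nM'] ->]; exists (phi @^-1` (subgroupI M M')) => //.
    exists (subgroupI M M') => //; split; first exact: openI.
    by move=> x _; apply: nrmI; [exact: nM|exact: nM'].
  - move=> _ [M [oM nM] ->]; apply: preimage_closed; last exact: open_subgroup_closed.
    by move=> x _; exact: phi_cont.
  (* An element of all these preimages maps into every open normal subgroup of [P], hence to 1 since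
     [P] is Hausdorff; so it lies in [K]. *)
  - move=> x [Wx Qx] f fs.
    suff Kx : K x by split; apply: KWK; apply/kernel_normal.
    apply/KP; apply: (hP) => U V Ux V1.
    have h : (fun y : P => phi x * y^-1) @ (1 : P) --> phi x.
      rewrite -[X in _ --> X]mulg1 -[X in _ --> _ * X]invg1.
      by apply: cvg_mulg; [exact: cvg_cst|apply: cvg_invg; exact: cvg_id].
    have Ux' : nbhs (1 : P) [set y | U (phi x * y^-1)] by exact: h Ux.
    have := near_normal_core hP dP lP (C := gen [set: P]) _ (filterI Ux' V1).
    have -> : (gen [set: P] : set P) = [set: P].
      by apply/seteqP; split=> // y _; exact: sub_gen.
    move=> /(_ cP) [M [oM MU nM]].
    have Mx : M (phi x) by apply: (Qx (phi @^-1` M)); exists M.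
    exists 1; split; last exact: nbhs_singleton.
    by have [] := MU _ Mx; rewrite /= mulgV.
pose MX : subgroup X := {| subgroup_set := phi @^-1` M;
  subgroup1 := ltac:(by rewrite /preimage /= (morph_group1 phiM); exact: subgroup1);
  subgroupM := ltac:(by move=> x y; rewrite /preimage /= phiM; exact: subgroupM);
  subgroupV := ltac:(by move=> x; rewrite /preimage /= (morph_groupV phiM); exact: subgroupV) |}.
have oMX : open (MX : set X) by apply: open_comp => // x _; exact: phi_cont.
have nMX x : nrm MX x.
  by move=> y; rewrite /= /preimage /= (morph_groupJ phiM); exact: nM.
have KMX : K `<=` MX.
  by move=> x /KP px; rewrite /= /preimage /= px; exact: subgroup1.
(* Modulo [K] an element of [T] is an element of [W] and [MX], whose conjugates by members of [s]
   and their inverses stay in [WK]. Hence [s] normalises [T]. *)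
pose T := subgroupI MX WK.
have oT : open (T : set X) by exact: openI.
have KT : K `<=` T by move=> x Kx; split; [exact: KMX|exact: KWK].
have oL : open (gen ((W `|` K) `|` [set` s]) : set X).
  by apply: gen_open oW _ => x Wx; left; left.
apply: (elem_extension_open tX oT oL).
- move=> x [_ /WKP [k [w [Kk Ww ->]]]]; apply: subgroupM; apply: sub_gen.
    by left; right.
  by left; left.
- apply: gen_min => x [[Wx|Kx]|/= xs].
  + by apply: nrmI => //; apply: nrm_self; exact: WWK.
  + by apply: nrmI => //; apply: nrm_self; exact: KWK.
  + have hT y : T y -> WK (y ^ x) /\ WK (y ^ x^-1).
      move=> [My /WKP [k [w [Kk Ww E]]]].
      have Mw : MX w.
        by rewrite -(mulKg k w) -E; apply: subgroupM => //; apply: subgroupV; exact: KMX.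
      have [h1 h2] := MO w (conj Ww Mw) x xs.
      have Kx g : WK (k ^ g) by apply: KWK; apply/kernel_normal.
      by rewrite E !conjMg; split; apply: subgroupM.
    by apply: nrmP => y Ty; have [h1 h2] := hT y Ty; split=> //; apply/nMX; case: Ty.
- apply: (elem_extension_compact tX (C := W) _ _ KT) => //.
  + exact: open_subgroup_closed.
  + have -> : K = phi @^-1` [set 1] :> set X by apply/seteqP; split=> x /KP.
    apply: preimage_closed => [x _|]; first exact: phi_cont.
    by apply: compact_closed => //; exact: compact_set1.
  + by move=> x _; exact: kernel_normal.
  + by move=> x [_ /WKP].
Qed.

End Kernel.

Lemma elem_trivial (G : topologicalGroupType) (K : subgroup G) :
  tdlcsc G -> (forall x, K x -> x = 1) -> elem K.
Proof.
move=> [hG dG lG sG] K1; apply: elementary_profinite; last exact: subgroup_second_countable.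
split.
- exact: hausdorff_injection (@sub_val_continuous G K) (@sub_val_inj G K) hG.
- exact: totally_disconnected_injection (@sub_val_continuous G K) (@sub_val_inj G K) dG.
- have -> : [set: subgroup_group K] = [set 1].
    apply/seteqP; split=> // x _; apply: sub_val_inj; exact: K1 (sub_val_in x).
  exact: compact_set1.
Qed.

Definition preim_subgroup (X Y : groupType) (f : X -> Y)
  (fM : {morph f : x y / x * y}) (H : subgroup Y) : subgroup X.
Proof.
exists (f @^-1` H); rewrite /preimage /=.
- by rewrite (morph_group1 fM); exact: subgroup1.
- by move=> x y; rewrite fM; exact: subgroupM.
- by move=> x; rewrite (morph_groupV fM); exact: subgroupV.
Defined.

Definition one_subgroup (G : groupType) : subgroup G.
Proof.
exists [set 1] => //; first by move=> x y -> ->; rewrite /mkset mulg1.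
by move=> x ->; rewrite /mkset invg1.
Defined.

Section SubgroupMap.
Context (X Q : topologicalGroupType) (e : X -> Q).
Hypothesis eM : {morph e : x y / x * y}.
Hypothesis ce : continuous e.
Hypothesis ei : injective e.

Definition sub_map (H : subgroup Q) (x : subgroup_group (preim_subgroup eM H)) :
  subgroup_group H := @sub_mk Q H (e (sub_val x)) (sub_val_in x).

Lemma sub_mapM H : {morph @sub_map H : x y / x * y}.
Proof. by move=> x y; apply: sub_val_inj; rewrite sub_valM /sub_map !sub_mkK sub_valM eM. Qed.

Lemma sub_map_continuous H : continuous (@sub_map H).
Proof.
apply: set_type_continuous => x.
by apply: (@continuous_comp _ _ _ (@sub_val X _) e); [exact: sub_val_continuous|exact: ce].
Qed.

Lemma sub_map_inj H : injective (@sub_map H).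
Proof.
move=> x y xy; apply: sub_val_inj; apply: ei.
by have := congr1 (@sub_val Q H) xy.
Qed.

End SubgroupMap.

(** Induction on the construction of [Q], for all [X] at once. In an extension, [e] followed by the
    projection to the quotient has as kernel the preimage of [H], elementary by induction, and the
    kernel lemmas apply. The base cases are the same with trivial kernel; unions and isomorphisms
    pull back directly. *)
Theorem elementary_injection (Q : topologicalGroupType) : elementary Q ->
  forall (X : topologicalGroupType) (e : X -> Q), tdlcsc X ->
  {morph e : x y / x * y} -> continuous e -> injective e -> elementary X.
Proof.
have ker1 (P X : topologicalGroupType) (e : X -> P) (eM : {morph e : x y / x * y}) :
    injective e -> forall x, one_subgroup X x <-> e x = 1.
  move=> ei x; split=> [->|]; first exact: morph_group1.
  by rewrite -(morph_group1 eM) => /ei.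
elim=> {Q} [Q pQ sQ|Q dQ cQ|Q H tQ cH eH IH PQ|Q O tQ oO iO UO eO IH
  |Q R [f [g [fK gK fM cf cg]]] eQ IH] X e tX eM ce ei.
- by apply: (elem_kernel_profinite tX eM ce (ker1 _ _ _ eM ei)) => //; apply: elem_trivial.
- by apply: (elem_kernel_discrete tX eM ce (ker1 _ _ _ eM ei)) => //; apply: elem_trivial.
- have cpi : continuous (fun x => quotg_pi H (e x)).
    by move=> x; apply: (@continuous_comp _ _ _ e); [exact: ce|exact: quotg_pi_continuous].
  have piM : {morph (fun x => quotg_pi H (e x) : quotient_group H) : x y / x * y}.
    by move=> x y; rewrite eM -quotg_piM.
  have KP x : preim_subgroup eM H x <-> quotg_pi H (e x) = 1 :> quotient_group H.
    rewrite (_ : 1 = quotg_pi H 1) //; split=> [Hx|/esym /quotg_piP].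
      by apply/esym/quotg_piP; rewrite invg1 mul1g.
    by rewrite invg1 mul1g.
  have eK : elem (preim_subgroup eM H).
    apply: (IH _ (@sub_map _ _ _ eM H)).
    + by apply: subgroup_tdlcsc => //; apply: preimage_closed => // x _; exact: ce.
    + exact: sub_mapM.
    + exact: sub_map_continuous.
    + exact: sub_map_inj.
  case: PQ => PQ.
    exact: (elem_kernel_profinite tX piM cpi KP eK).
  exact: (elem_kernel_discrete tX piM cpi KP eK).
- have oO' i : open (preim_subgroup eM (O i) : set X).
    by apply: open_comp => // x _; exact: ce.
  apply: (@elementary_union X (fun i => preim_subgroup eM (O i))) => //.
  + by move=> i x; exact: iO.
  + apply/seteqP; split=> // x _; have : [set: Q] (e x) by [].
    by rewrite -UO => -[i _ Oi]; exists i.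
  + move=> i; apply: (IH i _ (@sub_map _ _ _ eM (O i))).
    * by apply: subgroup_tdlcsc => //; exact: open_subgroup_closed.
    * exact: sub_mapM.
    * exact: sub_map_continuous.
    * exact: sub_map_inj.
- apply: (IH X (g \o e)) => //.
  + by move=> x y /=; rewrite -[RHS]fK fM !gK eM.
  + by move=> x; apply: continuous_comp; [exact: ce|exact: cg].
  + by move=> x y /= xy; apply: ei; rewrite -[e x]gK xy gK.
Qed.

Lemma elem_sub (G : topologicalGroupType) (A B : subgroup G) :
  tdlcsc G -> closed (A : set G) -> A `<=` B -> elem B -> elem A.
Proof.
move=> tG cA AB eB.
apply: (elementary_injection eB (e := fun x => sub_mk (AB _ (sub_val_in x)))) => //.
- exact: subgroup_tdlcsc.
- by move=> x y; apply: sub_val_inj.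
- move=> x V /sub_val_nbhs [V' /= V'x V'V].
  have V'x' : nbhs x (@sub_val G A @^-1` V') by exact: (@sub_val_continuous G A x V' V'x).
  by apply: filterS V'x' => y V'y; exact: V'V.
- by move=> x y /(congr1 (@sub_val G B)) xy; apply: sub_val_inj.
Qed.

(** * Iterated commutators and local solvability of groups in [A] *)

Section CommutatorSets.
Context (G : groupType).

(* Iterated commutator sets; unlike the derived series no subgroup is
   generated, so that they commute with arbitrary restrictions and images. *)
Fixpoint comm_set (d : nat) (S : set G) : set G :=
  if d is d'.+1 then
    [set z | exists a b, [/\ comm_set d' S a, comm_set d' S b & z = [~ a, b]]]
  else S.

Lemma comm_set_add d e (S : set G) : comm_set (d + e) S = comm_set d (comm_set e S).
Proof. by elim: d => //= d ->. Qed.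

Lemma comm_set_subgroup d (H : subgroup G) : comm_set d H `<=` H.
Proof.
elim: d => // d IH z [a [b [/IH Ha /IH Hb ->]]].
by apply: subgroupM; [exact: subgroupV|apply: subgroupM; [exact: subgroupV|exact: subgroupM]].
Qed.

End CommutatorSets.

Lemma comm_set_morph (G H : groupType) (f : G -> H) d (S : set G) (T : set H) :
  {morph f : x y / x * y} -> (forall x, S x -> T (f x)) ->
  forall z, comm_set d S z -> comm_set d T (f z).
Proof.
move=> fM ST; elim: d => // d IH z [a [b [Sa Sb ->]]].
by exists (f a), (f b); split; [exact: IH|exact: IH|exact: morph_groupR].
Qed.

Lemma comm_set_image (G H : groupType) (f : G -> H) d (S : set G) :
  {morph f : x y / x * y} -> comm_set d (f @` S) `<=` f @` comm_set d S.
Proof.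
move=> fM; elim: d => // d IH _ [_ [_ [/IH[a Sa <-] /IH[b Sb <-] ->]]].
by exists [~ a, b]; [exists a, b|exact: morph_groupR].
Qed.

Lemma comm_set_sub (G : groupType) d (S T : set G) :
  S `<=` T -> comm_set d S `<=` comm_set d T.
Proof. by move=> ST; apply: (comm_set_morph (f := id)). Qed.

Lemma comm_set_conj (G : groupType) d (S T : set G) g :
  (forall x, S x -> T (x ^ g)) -> forall z, comm_set d S z -> comm_set d T (z ^ g).
Proof. by apply: (comm_set_morph (f := fun z => z ^ g)) => x y; rewrite conjMg. Qed.

Lemma nrm_comm_set (G : topologicalGroupType) d (S : set G) :
  nrm S `<=` nrm (comm_set d S).
Proof.
apply: sub_nrm => [|x g]; first exact: subgroupV.
by move=> Sx Sg; apply: comm_set_conj Sx => x' /Sg.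
Qed.

(** This computes commutators modulo [M] without forming a quotient: for [c] in [B], which
    normalises [M], the relation of lying in [M c] respects products and inverses. *)
Lemma comm_set_mod (G : topologicalGroupType) d (M B : subgroup G) (X : set G) :
  B `<=` nrm M -> (forall x, X x -> exists m b, [/\ M m, B b & x = m * b]) ->
  forall z, comm_set d X z -> exists m b, [/\ M m, comm_set d B b & z = m * b].
Proof.
move=> BM XMB; pose R z c := exists2 m, M m & z = m * c.
have MB c x : B c -> M x -> M (x ^ c) by move=> /BM Mc Mx; rewrite /= Mc.
have RM z c z' c' : B c -> R z c -> R z' c' -> R (z * z') (c * c').
  move=> Bc [m Mm ->] [m' Mm' ->]; exists (m * m' ^ c^-1).
    by apply: subgroupM => //; apply: MB => //; exact: subgroupV.
  by rewrite conjgE !gnorm.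
have RV z c : B c -> R z c -> R z^-1 c^-1.
  move=> Bc [m Mm ->]; exists (m^-1 ^ c); first by apply: MB => //; exact: subgroupV.
  by rewrite conjgE !gnorm.
suff H z : comm_set d X z -> exists2 b, comm_set d B b & R z b.
  by move=> z /H [b Bb [m Mm ->]]; exists m, b.
elim: d z => [z /XMB [m [b [Mm Bb ->]]]|d IH _ [a [a' [/IH [b Bb ab] /IH [b' Bb' ab'] ->]]]].
  by exists b => //; exists m.
have Hb := comm_set_subgroup Bb; have Hb' := comm_set_subgroup Bb'.
exists [~ b, b']; first by exists b, b'.
by apply: (RM) (RV _ _ Hb ab) _; [exact: subgroupV|apply: (RM) (RV _ _ Hb' ab') _;
  [exact: subgroupV|exact: RM]].
Qed.

Definition locally_solvable (U : topologicalGroupType) (A : set U) :=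
  exists V d, nbhs (1 : U) V /\ comm_set d (V `&` A) `<=` [set 1].

Section LocallySolvable.
Context (U : topologicalGroupType).

Lemma locally_solvable_sub (H : subgroup U) :
  locally_solvable [set: subgroup_group H] -> locally_solvable (H : set U).
Proof.
move=> [V [d [V1 Vd]]]; have [V' V'1 V'V] := sub_val_nbhs V1.
exists V', d; split=> // z Dz.
have : comm_set d (@sub_val U H @` (@sub_val U H @^-1` V')) z.
  apply: comm_set_sub Dz => x [V'x Hx]; by exists (sub_mk Hx).
move=> /(comm_set_image (@sub_valM U H)) [x Dx <-].
suff -> : x = 1 by [].
by apply: Vd; apply: comm_set_sub Dx => y /V'V.
Qed.

Hypothesis pU : profinite U.

Lemma compact_product (P S : subgroup U) : compact (P : set U) -> compact (S : set U) ->
  S `<=` nrm P -> compact (gen ((P : set U) `|` S) : set U).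
Proof.
move=> cP cS SP; have MP := gen_mulP SP.
have -> : (gen ((P : set U) `|` S) : set U) =
    (fun z : U * U => z.1 * z.2) @` ((P : set U) `*` (S : set U)).
  apply/seteqP; split=> x.
    by move=> /MP [n [w [Pn Sw ->]]]; exists (n, w).
  by move=> [[n w] /= [Pn Sw] <-]; apply/MP; exists n, w.
apply: continuous_compact; last exact: compact_setX.
by apply: continuous_subspaceT; exact: mulg_continuous.
Qed.

(* If w = p s is close to 1 then p is close to some z in P :&: S, and
   w = (p z^-1) (z s) with both factors close to 1. *)
Lemma near_product (P S N : subgroup U) :
  compact (P : set U) -> closed (S : set U) ->
  [set: U] `<=` nrm P -> [set: U] `<=` nrm S -> [set: U] `<=` nrm N ->
  open (N : set U) ->
  \forall w \near (1 : U), gen ((P : set U) `|` S) w ->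
    exists p s, [/\ subgroupI P N p, subgroupI S N s & w = p * s].
Proof.
move=> cP cS nP nS nN oN.
have MP := gen_mulP (subset_trans (@subsetT _ _) nP : (S : set U) `<=` nrm P).
pose Q (w p : U) := P p -> S (p^-1 * w) ->
  exists p s, [/\ subgroupI P N p, subgroupI S N s & w = p * s].
have /compact_near_coveringP cP' := cP.
have : \forall w \near (1 : U), P `<=` Q w.
  apply: (cP' U (nbhs (1 : U)) Q) => p Pp.
  (* If [p] is in [S], it serves as the element [z], and [w] splits as [(p' p^-1) (p p'^-1 w)] for
     [p'] near [p]. Otherwise [p'^-1 w] stays outside [S] nearby and the claim is vacuous. *)
  have [Sp|nSp] := pselect (S p).
    have h1 : \forall p' \near p & w \near (1 : U), N (p^-1 * p') /\ N w.
      exists ((fun p' => N (p^-1 * p')), (N : set U)) => //=.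
      by split; [apply: near_translate|]; exact: nbhs_subgroup.
    move: h1; apply: filterS => -[p' w] /= [Np' Nw] Pp' Sw.
    pose n := p^-1 * p'.
    have Pn : P n by apply: subgroupM => //; exact: subgroupV.
    exists (n ^ p^-1), ((n ^ p^-1)^-1 * w); split; last by rewrite mulVKg.
      by split; [apply/nP|apply/nN].
    have Nn : N ((n ^ p^-1)^-1) by apply: subgroupV; apply/nN.
    split; last exact: subgroupM.
    have -> : (n ^ p^-1)^-1 * w = p * (p'^-1 * w) by rewrite /n conjgE !gnorm.
    exact: subgroupM.
  have h : (fun z : U * U => z.1^-1 * z.2) @ ((p, 1) : U * U) --> p^-1.
    rewrite -[X in _ --> X]mulg1; apply: cvg_mulg; last exact: cvg_snd.
    by apply: cvg_invg; exact: cvg_fst.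
  have nV : nbhs p^-1 (~` (S : set U)).
    apply: open_nbhs_nbhs; split; first exact: closed_openC.
    by move=> /= /subgroupV; rewrite invgK.
  have h2 : \forall p' \near p & w \near (1 : U), ~ S (p'^-1 * w) by exact: h nV.
  by move: h2; apply: filterS => -[p' w] /= nS' _ /nS'.
apply: filterS => w Pw /MP [p [s [Pp Ss E]]].
by apply: (Pw p Pp) => //; rewrite E mulKg.
Qed.

(** Elements near 1 are products [p s] with both factors in a small open normal [N]. Modulo
    [subgroupI P N] their [e]-th commutators are those of [subgroupI S N], hence trivial; so they
    lie in [subgroupI P N], where [d] further commutators reach 1. *)
Lemma locally_solvable_product (P S : subgroup U) :
  compact (P : set U) -> closed (S : set U) ->
  [set: U] `<=` nrm P -> [set: U] `<=` nrm S ->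
  locally_solvable (P : set U) -> locally_solvable (S : set U) ->
  locally_solvable (gen ((P : set U) `|` S) : set U).
Proof.
move=> cP cS nP nS [VP [d [VP1 VPd]]] [VS [e [VS1 VSe]]].
have [hU tU cU] := pU.
have := near_normal_core hU tU (profinite_locally_compact pU) (C := gen [set: U]) _ (filterI VP1 VS1).
have -> : (gen [set: U] : set U) = [set: U].
  by apply/seteqP; split=> // y _; exact: sub_gen.
move=> /(_ cU) [N [oN NV nN]].
pose Om w := gen ((P : set U) `|` S) w ->
  exists p s, [/\ subgroupI P N p, subgroupI S N s & w = p * s].
have Om1 : nbhs (1 : U) Om by exact: near_product.
exists Om, (d + e); split=> //.
rewrite comm_set_add => z Dz; apply: VPd; apply: comm_set_sub Dz => {}z Dz.
suff : subgroupI P N z by move=> [Pz /NV[]].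
have [||m [b [Mm Bb ->]]] := @comm_set_mod U e (subgroupI P N) (subgroupI S N) _ _ _ z Dz.
- by move=> x _; apply: nrmI; [exact: nP|exact: nN].
- by move=> x [Omx gx]; exact: Omx.
suff -> : b = 1 by rewrite mulg1.
by apply: VSe; apply: comm_set_sub Bb => x [Sx /NV[]].
Qed.

End LocallySolvable.

Lemma nrmU (G : topologicalGroupType) (S T : set G) g :
  nrm S g -> nrm T g -> nrm (S `|` T) g.
Proof.
move=> Sg Tg x; split=> -[].
- by move=> /Sg; left.
- by move=> /Tg; right.
- by move=> Sx; left; apply/Sg.
- by move=> Tx; right; apply/Tg.
Qed.

Lemma nrm_gen2 (G : topologicalGroupType) (P S : subgroup G) g :
  nrm P g -> nrm S g -> nrm (gen ((P : set G) `|` S)) g.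
Proof. by move=> Pg Sg; apply: nrm_gen; exact: nrmU. Qed.

(** One commutator kills an abelian group, and in a finite group 1 is isolated. Commutator sets
    restrict to subgroups and lift along quotient maps. *)
Theorem classA_locally_solvable (U : topologicalGroupType) :
  classA U -> locally_solvable [set: U].
Proof.
elim=> {U} [U _ aU|U [hU _ _] fU _|U K _ IH cK|U K _ [V [d [V1 Vd]]] cK
  |U n V pU cV UV _ IH
  |U W [f [g [fK gK fM cf cg]]] _ [V [d [V1 Vd]]]].
- exists [set: U], 1%N; split; first exact: filterT.
  by move=> z [a [b [_ _ ->]]]; apply/eqP/commgP; exact: aU.
- exists [set 1], 0%N; split; last by move=> z [].
  apply: open_nbhs_nbhs; split=> //; rewrite -[X in open X]setCK.
  apply: closed_openC; apply: compact_closed => //; apply: finite_compact.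
  exact: sub_finite_set fU.
- have [V [d [V1 Vd]]] := IH; exists (@sub_val U K @^-1` V), d; split.
    exact: (@sub_val_continuous U K 1 V V1).
  move=> z Dz; apply: sub_val_inj; apply: Vd.
  by apply: (comm_set_morph (@sub_valM U K)) Dz => x [Vx _].
- have piM : {morph (quotg_pi K : U -> quotient_group K) : x y / x * y}.
    by move=> x y; rewrite -quotg_piM.
  exists (@quotg_pi U K @` V), d; split; first exact: quotg_pi_nbhs.
  move=> z Dz; have Dz' : comm_set d (@quotg_pi U K @` V) z.
    by apply: comm_set_sub Dz => x [].
  have [x Dx <-] := comm_set_image piM Dz'.
  suff -> : x = 1 by [].
  by apply: Vd; apply: comm_set_sub Dx => y.
- have [hU tU cU] := pU.
  (* The factors [V i] are multiplied together one at a time, keeping a compact normal locally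
     solvable subgroup. *)
  have [P [cP nP PV lP]] : exists P : subgroup U, [/\ compact (P : set U),
      [set: U] `<=` nrm P, forall i x, V i x -> P x & locally_solvable (P : set U)].
    have : exists P : subgroup U, [/\ compact (P : set U),
      [set: U] `<=` nrm P, forall i, i \in enum 'I_n -> forall x, V i x -> P x
      & locally_solvable (P : set U)].
      elim: (enum 'I_n) => [|i s [P [cP nP PV lP]]].
        exists (one_subgroup U); split.
        - exact: compact_set1.
        - by move=> g _; apply: nrmP => x ->; rewrite /= conj1g.
        - by move=> i; rewrite in_nil.
        - exists [set: U], 0%N; split; first exact: filterT.
          by move=> z [].
      have cVi : compact (V i : set U) by exact: subclosed_compact (cV i) cU _.
      have nVi : [set: U] `<=` nrm (V i) by exact: nrm_normal.
      exists (gen ((P : set U) `|` V i)); split.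
      - by apply: compact_product => // x _; exact: nP.
      - by move=> g _; apply: nrm_gen2; [exact: nP|exact: nVi].
      - move=> j; rewrite inE => /orP[/eqP -> x Vx|js x Vx]; apply: sub_gen.
          by right.
        by left; exact: (PV _ js).
      - apply: locally_solvable_product => //.
        by apply: locally_solvable_sub; exact: IH.
    move=> [P [cP nP PV lP]]; exists P; split=> // i x; apply: PV.
    by rewrite mem_enum.
  suff <- : (P : set U) = [set: U] by [].
  apply/seteqP; split=> // u _; have [v Vv ->] := UV u.
  by elim/big_ind: _ => [|x y|i _]; [exact: subgroup1|exact: subgroupM|exact: (PV i)].
- have gM : {morph g : x y / x * y}.
    by move=> x y; rewrite -{1}[x]gK -{1}[y]gK -fM fK.
  exists (g @^-1` V), d; split.
    by apply: cg; rewrite (morph_group1 gM).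
  move=> z Dz; rewrite -[z]gK -(morph_group1 fM); congr f; apply: Vd.
  by apply: (comm_set_morph gM) Dz => x [Vx _].
Qed.

(** * Elementary groups generated modulo a solvable germ *)

Lemma commgV_conj (G : groupType) (m f : G) : [~ m, f^-1] = [~ m, f]^-1 ^ f^-1.
Proof. by rewrite /commg !conjgE !gnorm. Qed.

(** As [z ^ c = z * [~ z, c]], conjugation by [c] keeps the generators in the group; the hypothesis
    passes to [c^-1] by [commgV_conj]. *)
Lemma nrm_gen_comm (G : topologicalGroupType) (N : subgroup G) (S : set G) c :
  nrm N c -> (forall z, S z -> N [~ z, c]) -> nrm (gen ((N : set G) `|` S)) c.
Proof.
move=> Nc Sc; set K := gen _.
have NK : N `<=` K by move=> n Nn; apply: sub_gen; left.
have KJ g : nrm N g -> (forall z, S z -> N [~ z, g]) -> forall x, K x -> K (x ^ g).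
  move=> Ng Sg x; apply: (@gen_min _ _ (preim_subgroup
     (f := fun z => z ^ g) (fun x y => conjMg x y g) K)) => z [Nz|Sz].
    by apply: NK; apply/Ng.
  change (K (z ^ g)); have -> : z ^ g = z * [~ z, g] by rewrite mulVKg.
  by apply: subgroupM; [apply: sub_gen; right|apply: NK; exact: Sg].
apply: nrmP; first exact: KJ.
apply: KJ => [|z Sz]; first exact: subgroupV.
rewrite commgV_conj; have NcV : nrm N c^-1 by exact: subgroupV.
by apply/NcV; apply: subgroupV; exact: Sc.
Qed.

Section SolvableGeneration.
Context (G : topologicalGroupType).
Hypothesis tG : tdlcsc G.

Let hG : hausdorff_space G. Proof. by have [] := tG. Qed.
Let dG : totally_disconnected [set: G]. Proof. by have [] := tG. Qed.
Let lG : locally_compact [set: G]. Proof. by have [] := tG. Qed.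

(** The normaliser of the germ of [Y] at 1; it is a group because conjugations are continuous and
    fix 1. *)
Definition nrm_germ (Y : set G) : subgroup G.
Proof.
exists [set g | \forall v \near (1 : G), Y (v ^ g) <-> Y v].
- by apply: nearW => v; rewrite conjg1.
- move=> g h Yg Yh.
  have Yh' : \forall v \near (1 : G), Y ((v ^ g) ^ h) <-> Y (v ^ g) 
    by exact: (@near_conjg G g [set v | Y (v ^ h) <-> Y v]).
  by apply: filterS2 Yg Yh' => v Yg' Yh''; rewrite conjgM Yh'' Yg'.
- move=> g Yg.
  have Yg' : \forall v \near (1 : G), Y ((v ^ g^-1) ^ g) <-> Y (v ^ g^-1) 
    by exact: (@near_conjg G g^-1 [set v | Y (v ^ g) <-> Y v]).
  by apply: filterS Yg' => v; rewrite conjgKV => ->.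
Defined.

Lemma closure_sub_closed (A B : set G) : closed B -> A `<=` B -> closure A `<=` B.
Proof. by move=> cB AB; rewrite closureE; exact: smallest_sub. Qed.

(** For finitely many [f], a common open [M] inside [W], normalised by [W], commutes with each [f]
    modulo [N]. Then [N M] is open, compact modulo [N], and normal in the generated group. *)
Lemma elem_gen_abelian (W N : subgroup G) (F : set G) :
  open (W : set G) -> compact (W : set G) -> closed (N : set G) -> elem N ->
  W `<=` nrm N -> F `<=` nrm N ->
  (forall f, F f -> \forall v \near (1 : G), N [~ v, f]) ->
  elem (gen (((W : set G) `|` N) `|` F)).
Proof.
move=> oW cW cN eN WN FN Fv.
apply: (elem_gen_finite tG oW) => [|s sF]; first exact: subsetUl.
have V1 : nbhs (1 : G) [set v | forall f, f \in s -> N [~ v, f]].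
  by apply: filter_seq => f fs; apply: Fv; exact: sF.
have [M [oM MV WM]] := near_normal_core hG dG lG cW (filterI V1 (nbhs_subgroup oW)).
have MW : M `<=` W by move=> x /MV[].
have MN : M `<=` nrm N by move=> x /MW /WN.
pose T := gen ((N : set G) `|` M); have TP := gen_mulP MN.
have NT : N `<=` T by move=> x Nx; apply: sub_gen; left.
have MT : M `<=` T by move=> x Mx; apply: sub_gen; right.
have oT : open (T : set G) by apply: gen_open oM _; exact: subsetUr.
have oL : open (gen (((W : set G) `|` N) `|` [set` s]) : set G).
  by apply: gen_open oW _ => x Wx; left; left.
have TN : T `<=` nrm N by apply: gen_min => x [Nx|Mx]; [exact: nrm_self|exact: MN].
apply: (elem_extension_open tG oT oL).
- apply: gen_min => x [Nx|/MW Wx]; apply: sub_gen; left; by [right|left].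
- apply: gen_min => x [[Wx|Nx]|/= xs].
  + by apply: nrm_gen2; [exact: WN|exact: WM].
  + by apply: nrm_self; exact: NT.
  + by apply: nrm_gen_comm => [|z /MV[Nz _]]; [apply: FN; exact: sF|exact: Nz].
- apply: (elem_extension_compact tG (C := W) _ cN NT TN) => //.
    exact: open_subgroup_closed.
  by move=> x /TP [n [w [Nn /MW Ww E]]]; exists n, w.
Qed.

(* Induction on d. The conjugates c = a^g of elements a of comm_set d Y commute
   modulo N with the d-th commutators of a small enough part of Y; hence N can be
   enlarged so as to absorb first those commutators, which makes finitely many
   conjugates c generate an elementary group, and then all of the conjugates c
   themselves, which decreases d. *)
Theorem elem_gen_solvable d (W N Y : subgroup G) (F : set G) :
  open (W : set G) -> compact (W : set G) -> closed (N : set G) -> elem N ->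
  Y `<=` W -> W `<=` nrm N -> F `<=` nrm N -> W `<=` nrm Y ->
  comm_set d Y `<=` N ->
  (forall f, F f -> \forall v \near (1 : G), Y [~ v, f]) ->
  elem (gen (((W : set G) `|` N) `|` F)).
Proof.
elim: d N Y F => [|d IH] N Y F oW cW cN eN YW WN FN WY YN Fv.
  (* For [d = 0] the group [Y] lies in [N]. *)
  by apply: elem_gen_abelian => // f /Fv; apply: filterS => v; exact: YN.
pose O := gen ((W : set G) `|` F).
have WO : W `<=` O by move=> x Wx; apply: sub_gen; left.
have FO : F `<=` O by move=> x Wx; apply: sub_gen; right.
have ON : O `<=` nrm N by apply: gen_min => x [Wx|Fx]; [exact: WN|exact: FN].
(* [W] normalises [Y], and conjugation by an element of [F] multiplies elements near 1 by elements
   of [Y]. *)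
have OY : O `<=` nrm_germ Y.
  apply: gen_min => f [/WY Yf|/Fv Yf]; first by apply: nearW => v; exact: Yf.
  apply: filterS Yf => v Yf.
  have -> : v ^ f = v * [~ v, f] by rewrite mulVKg.
  split=> Yv; last exact: subgroupM.
  by rewrite -(mulgK [~ v, f] v); apply: subgroupM => //; exact: subgroupV.
have NJ g x : O g -> N x -> N (x ^ g) by move=> /ON Ng Nx; apply/Ng.
pose C := [set c | exists a g, [/\ comm_set d Y a, O g & c = a ^ g]].
have CO : C `<=` O.
  move=> _ [a [g [Ya Og ->]]]; apply: subgroup_conj => //; apply: WO; apply: YW.
  exact: comm_set_subgroup Ya.
(* Conjugation by [g^-1] turns the commutator into [[~ z ^ g^-1, a]], an element of
   [comm_set d.+1 Y] when the entries of [z] are close to 1; it lies in [N], which [g]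
   normalises. *)
have comm1 c : C c -> exists2 P, nbhs (1 : G) P &
    forall z, comm_set d ((Y : set G) `&` P) z -> N [~ z, c].
  move=> [a [g [Ya Og ->]]]; have OgV := subgroupV Og.
  exists [set y | Y (y ^ g^-1) <-> Y y]; first exact: OY OgV.
  move=> z Dz; have Dz' : comm_set d Y (z ^ g^-1).
    by apply: comm_set_conj Dz => x [Yx /= h]; apply/h.
  have -> : [~ z, a ^ g] = [~ z ^ g^-1, a] ^ g by rewrite conjRg conjgKV.
  by apply: NJ => //; apply: YN; exists (z ^ g^-1), a.
(* Here [[~ v ^ g^-1, a]] lies in [Y] because [a] does and [v ^ g^-1] is in [W]; conjugating back by
   [g] preserves the germ of [Y]. *)
have comm2 c : C c -> \forall v \near (1 : G), Y [~ v, c].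
  move=> [a [g [Da Og ->]]]; have Ya := comm_set_subgroup Da.
  have h1 : \forall v \near (1 : G), Y ([~ v, a] ^ g) <-> Y [~ v, a].
    by apply: (@near_commg G a [set u | Y (u ^ g) <-> Y u]); exact: OY.
  have h2 : \forall v \near (1 : G), Y ([~ v ^ g^-1, a] ^ g) <-> Y [~ v ^ g^-1, a].
    exact: (@near_conjg G g^-1 [set v | Y ([~ v, a] ^ g) <-> Y [~ v, a]]).
  have h3 : \forall v \near (1 : G), W (v ^ g^-1).
    by apply: (@near_conjg G g^-1 W); exact: nbhs_subgroup.
  apply: filterS2 h2 h3 => v; rewrite conjRg conjgKV => h2 /WY Wv; apply/h2.
  rewrite commgEr; apply: subgroupM => //.
  by apply/Wv; exact: subgroupV.
have eC : elem (gen (((W : set G) `|` N) `|` C)).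
  apply: (elem_gen_finite tG oW) => [|s sC]; first exact: subsetUl.
  have [V V1 Vs] : exists2 V, nbhs (1 : G) V & forall c, c \in s ->
      forall z, comm_set d ((Y : set G) `&` V) z -> N [~ z, c].
    elim: s sC => [|c s IHs] sC; first by exists [set: G] => //; exact: filterT.
    have [|V V1 Vs] := IHs; first by move=> x xs; apply: sC; rewrite inE xs orbT.
    have [|P P1 Pc] := comm1 c; first by apply: sC; rewrite inE eqxx.
    exists (P `&` V); first exact: filterI.
    move=> x; rewrite inE => /orP[/eqP ->|xs] z Dz; [apply: Pc|apply: (Vs _ xs)];
      by apply: comm_set_sub Dz => y [? []].
  have [M [oM MV WM]] := near_normal_core hG dG lG cW V1.
  (* [M] is so small that [comm_set d YM] commutes with every [c] in [s] modulo [N]. *)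
  pose YM := subgroupI Y M.
  have YMV : comm_set d YM `<=` comm_set d ((Y : set G) `&` V).
    by apply: comm_set_sub => x [Yx /MV Vx].
  have YMW : YM `<=` W by move=> x [/YW].
  have WYM : W `<=` nrm YM by move=> w Ww; apply: nrmI; [exact: WY|exact: WM].
  have EW : comm_set d YM `<=` W.
    by move=> x Ex; apply: YMW; exact: comm_set_subgroup Ex.
  (* [A] absorbs these commutators. It lies in [N W], so it is compact modulo [N], and [W] and [s]
     normalise it; the induction hypothesis applies to [A], [YM] and [s]. *)
  pose A0 := gen ((N : set G) `|` comm_set d YM); pose A := closure_subgroup A0.
  have cA : closed (A : set G) by exact: closed_closure.
  have A0A : A0 `<=` A by exact: subset_closure.
  have NA : N `<=` A by move=> x Nx; apply: A0A; apply: sub_gen; left.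
  have NWP := gen_mulP WN.
  have cNW : closed (gen ((N : set G) `|` W) : set G).
    by apply: open_subgroup_closed; apply: gen_open oW _; exact: subsetUr.
  have ANW : A `<=` gen ((N : set G) `|` W).
    by apply: closure_sub_closed => //; apply: gen_sub; exact: setUS.
  have NWN : gen ((N : set G) `|` W) `<=` nrm N by
    apply: gen_min => x [Nx|Wx]; [exact: nrm_self|exact: WN].
  have eA : elem A.
    apply: (elem_extension_compact tG (C := W) cA cN NA) => //.
      exact: subset_trans NWN.
    by move=> x /ANW /NWP.
  have eB : elem (gen (((W : set G) `|` A) `|` [set` s])).
    apply: (IH A YM) => //.
    - move=> w Ww; apply: nrm_closure; apply: nrm_gen; apply: nrmU; first exact: WN.
      by apply: nrm_comm_set; exact: WYM.
    - move=> c cs; apply: nrm_closure; apply: nrm_gen_comm.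
        by apply: ON; apply: CO; exact: sC.
      by move=> z /YMV; exact: Vs.
    - by move=> z Ez; apply: A0A; apply: sub_gen; right.
    - move=> c /= cs; apply: filterI; first by apply: comm2; exact: sC.
      by apply: near_commg; exact: nbhs_subgroup.
  apply: elem_sub eB => //.
    apply: open_subgroup_closed; apply: gen_open oW _ => w Ww; by left; left.
  by apply: gen_sub; apply: setSU; exact: setUS.
set B := gen _ in eC.
have cB : closed (B : set G).
  by apply: open_subgroup_closed; apply: gen_open oW _ => w Ww; left; left.
(* [N'] is elementary as a closed subgroup of [B], and contains [C], thus all of [comm_set d Y]; the
   induction hypothesis applies to [N'], [Y] and [F]. *)
pose N0 := gen ((N : set G) `|` C); pose N' := closure_subgroup N0.
have N0N' : N0 `<=` N' by exact: subset_closure.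
have cN' : closed (N' : set G) by exact: closed_closure.
have eN' : elem N'.
  apply: elem_sub eC => //; apply: closure_sub_closed => //.
  by apply: gen_sub; apply: setSU; exact: subsetUr.
have ON' : O `<=` nrm (closure_subgroup N0).
  move=> g Og; apply: nrm_closure; apply: nrm_gen; apply: nrmU; first exact: ON.
  suff : O `<=` nrm C by exact.
  apply: sub_nrm => [|_ h [a [k [Ya Ok ->]]] Oh]; first exact: subgroupV.
  by exists a, (k * h); split; [|exact: subgroupM|rewrite conjgM].
have eB : elem (gen (((W : set G) `|` N') `|` F)).
  apply: (IH N' Y) => //.
  - exact: subset_trans ON'.
  - exact: subset_trans ON'.
  - move=> a Ya; apply: N0N'; apply: sub_gen; right.
    by exists a, 1; split; [|exact: subgroup1|rewrite conjg1].
apply: elem_sub eB => //.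
  by apply: open_subgroup_closed; apply: gen_open oW _ => w Ww; left; left.
by apply: gen_sub; apply: setSU; apply: setUS => x Nx; apply: N0N'; apply: sub_gen; left.
Qed.

End SolvableGeneration.

(** * Germs of conjugates of a locally normal subgroup *)

Section LocalConjugates.
Context (G : topologicalGroupType).

Definition conj_subgroup (H : subgroup G) (g : G) : subgroup G :=
  preim_subgroup (f := fun x => x ^ g^-1) (fun x y => conjMg x y g^-1) H.

Lemma conj_subgroup_open (H : subgroup G) g :
  open (H : set G) -> open (conj_subgroup H g : set G).
Proof. by move=> oH; apply: open_comp => // x _; exact: conjg_continuous. Qed.

(** Complements of finite unions of cosets of [H] are closed, directed and have empty intersection,
    so one of them misses [C]. *)
Lemma finite_cosets (C : set G) (H : subgroup G) : compact C -> open (H : set G) ->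
  exists s : seq G, forall x, C x -> exists2 t, t \in s & H (x * t^-1).
Proof.
move=> cC oH; pose A (s : seq G) := [set x | forall t, t \in s -> ~ H (x * t^-1)].
have [||||_ [s _ <-] Cs] := @compact_directed G C set0 (range A) cC open0.
- by exists (A [::]), [::].
- move=> _ _ [s _ <-] [t _ <-]; exists (A (s ++ t)); first by exists (s ++ t).
  by move=> x Ax; split=> u us; apply: Ax; rewrite mem_cat us ?orbT.
- move=> _ [s _ <-]; rewrite -[A s]setCK; apply: open_closedC.
  have -> : ~` A s = \bigcup_(t in [set` s]) [set x | H (x * t^-1)].
    apply/seteqP; split=> [x nA|x [t ts Hx] Ax]; last exact: (Ax t).
    by apply: contrapT => nU; apply: nA => t ts Hx; apply: nU; exists t.
  apply: bigcup_open => t _; apply: (@open_comp _ _ (fun x => x * t^-1)) => // x _.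
  exact: mulg_continuousl.
- move=> x [_ Ax]; apply: (Ax (A [:: x])); first by exists [:: x].
    by rewrite inE.
  by rewrite mulgV; exact: subgroup1.
exists s => x Cx; apply: contrapT => nx.
by have [] := Cs x; split=> // t ts Hx; apply: nx; exists t.
Qed.

Variables (R B V1 : subgroup G) (d : nat).
Hypothesis nR : [set: G] `<=` nrm R.
Hypothesis oV1 : open (V1 : set G).
Hypothesis V1B : V1 `<=` nrm B.
Hypothesis BR : comm_set d B `<=` R.

(* Germs of locally normal subgroups normalise each other, so finitely many
   conjugates of B generate a solvable germ. *)
Lemma conjugates_germ (l : seq G) : exists (Y V : subgroup G) (e : nat),
  [/\ open (V : set G), V `<=` nrm Y, comm_set e Y `<=` R &
   forall g, g \in l -> \forall y \near (1 : G), B (y ^ g^-1) -> Y y].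
Proof.
have RJ x g : R x -> R (x ^ g) by move=> Rx; apply/(nR (I : [set: G] g)).
elim: l => [|g l [Y [V [e [oV VY YR Yl]]]]].
  exists (one_subgroup G), V1, 0%N; split=> //.
    by move=> v _; apply: nrmP => x ->; rewrite /= conj1g.
  by move=> x ->; exact: subgroup1.
(* [Z] is open and normalises [Y] and the conjugate of [B] by [g]; cut down to [Z], these two
   normalise each other. *)
pose Z := subgroupI V (conj_subgroup V1 g).
have oZ : open (Z : set G) by apply: openI => //; exact: conj_subgroup_open.
pose P := subgroupI Y Z; pose S := subgroupI (conj_subgroup B g) Z.
have ZP : Z `<=` nrm P.
  by move=> z Zz; apply: nrmI; [apply: VY; case: Zz|exact: nrm_self].
have ZS : Z `<=` nrm S.
  move=> z Zz; apply: nrmI; last exact: nrm_self.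
  have [_ V1z] := Zz => x.
  change (B ((x ^ z) ^ g^-1) <-> B (x ^ g^-1)).
  by rewrite conjJg; apply: (V1B V1z).
have SP : S `<=` nrm P by move=> x [_ /ZP].
have MP := gen_mulP SP.
exists (gen ((P : set G) `|` S)), Z, (e + d); split=> //.
- by move=> z Zz; apply: nrm_gen2; [exact: ZP|exact: ZS].
(* The [d] inner commutators bring [P S] into [R P], since those of [S] fall into the normal
   subgroup [R]; the [e] outer ones then bring [P] into [R]. *)
- rewrite comm_set_add => z Dz.
  have [||r [p [Rr Dp ->]]] := @comm_set_mod G e R P _ _ _ z Dz.
  + by move=> x _; exact: nR.
  + move=> x Dx; have [|m [b [Pm Sb ->]]] := @comm_set_mod G d P S _ SP _ x Dx.
      by move=> y /MP.
    exists (b ^ m^-1), m; split=> //; last by rewrite conjgE !gnorm.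
    apply: (RJ); rewrite -[b](conjgKV g); apply: RJ; apply: BR.
    by apply: comm_set_conj Sb => y [].
  + apply: subgroupM => //; apply: YR; apply: comm_set_sub Dp => y [].
    by [].
- move=> h; rewrite inE => /orP[/eqP ->|hl].
    apply: filterS (nbhs_subgroup oZ) => y Zy By; apply: sub_gen; right.
    by split.
  apply: filterS2 (Yl h hl) (nbhs_subgroup oZ) => y Yy Zy By; apply: sub_gen; left.
  by split=> //; exact: Yy.
Qed.

(** By compactness finitely many [h] represent all [g w] modulo [V1], which normalises [B]; so the
    conjugates of [B] by all [g w] are among finitely many. Their common [Y1] is replaced by the
    intersection of its conjugates under [W], which still contains the required germs. *)
Lemma invariant_conjugates_germ (W : subgroup G) (l : seq G) :
  open (W : set G) -> compact (W : set G) -> exists (Y : subgroup G) (e : nat),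
  [/\ Y `<=` W, W `<=` nrm Y, comm_set e Y `<=` R &
   forall g, g \in l -> \forall y \near (1 : G), B (y ^ g^-1) -> Y y].
Proof.
move=> oW cW.
have [l' l'P] : exists l' : seq G, forall g w, g \in l -> W w ->
    exists2 h, h \in l' & V1 (g * w * h^-1).
  elim: l => [|g l [l' l'P]]; first by exists [::].
  have cgW : compact ((fun w => g * w) @` W).
    apply: continuous_compact => //; apply: continuous_subspaceT => w.
    by apply: cvg_mulg; [exact: cvg_cst|exact: cvg_id].
  have [s sP] := finite_cosets cgW oV1.
  exists (s ++ l') => k w; rewrite inE => /orP[/eqP ->|kl] Ww.
    have [|t ts Ht] := sP (g * w); first by exists w.
    by exists t => //; rewrite mem_cat ts.
  have [h hl' Hh] := l'P k w kl Ww; exists h => //.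
  by rewrite mem_cat hl' orbT.
have [Y1 [_ [e [_ _ YR Yl]]]] := conjugates_germ l'.
pose Y2 : subgroup G := {| subgroup_set := [set x | forall w, W w -> Y1 (x ^ w)];
  subgroup1 := ltac:(by move=> c _; rewrite conj1g; exact: subgroup1);
  subgroupM := ltac:(by move=> x y Wx Wy c Cc; rewrite conjMg; apply: subgroupM; auto);
  subgroupV := ltac:(by move=> x Wx c Cc; rewrite conjVg; apply: subgroupV; auto) |}.
exists (subgroupI W Y2), e; split.
- by move=> x [].
- move=> w Ww; apply: nrmI; first exact: nrm_self.
  suff : W `<=` nrm Y2 by exact.
  apply: sub_nrm => [x|x h /= Y2x Wh v Wv]; first exact: subgroupV.
  by rewrite -conjgM; apply: Y2x; exact: subgroupM.
- apply: subset_trans YR; apply: comm_set_sub => x [_ /(_ 1 (subgroup1 W))].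
  by rewrite conjg1.
- move=> g gl.
  have Om : nbhs (1 : G) [set y | forall h, h \in l' -> B (y ^ h^-1) -> Y1 y].
    by apply: filter_seq => h hl'; exact: Yl.
  apply: filterS2 (near_compact_conjg cW Om) (nbhs_subgroup oW) => y Oy Wy By.
  split=> // w Ww; have [h hl' Vh] := l'P g w gl Ww.
  apply: (Oy w Ww h hl'); have := (V1B Vh (y ^ g^-1)).2 By.
  by rewrite -!conjgM mulgA mulKg.
Qed.

End LocalConjugates.

(** * Maximal closed normal elementary subgroups *)

Section MaximalNormal.
Context (G : topologicalGroupType).
Hypothesis tG : tdlcsc G.

Definition elem_normal (N : subgroup G) :=
  [/\ closed (N : set G), [set: G] `<=` nrm N & elem N].

(** Finitely many elements of the union lie in one member [N], and [N W] is elementary for a compact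
    open [W]. Hence [W] and the union generate an elementary group; being open it is closed, so it
    contains the closure. *)
Lemma elem_normal_chain (A : set (subgroup G)) : A !=set0 ->
  (forall N, A N -> elem_normal N) ->
  (forall M N, A M -> A N -> M `<=` N \/ N `<=` M) ->
  elem_normal (closure_subgroup (gen (\bigcup_(N in A) (N : set G)))).
Proof.
move=> [N0 AN0] AP Atot; have [hG dG lG _] := tG.
set S := \bigcup_(N in A) _.
have [W [oW cW _]] := van_dantzig hG dG lG (@filterT _ _ (nbhs_filter (1 : G))).
have eWS : elem (gen ((W : set G) `|` S)).
  apply: (elem_gen_finite tG oW) => // s sS.
  have [N AN sN] : exists2 N, A N & forall x, x \in s -> N x.
    elim: s sS => [|x s IH] sS; first by exists N0.
    have [|N AN sN] := IH; first by move=> y ys; apply: sS; rewrite inE ys orbT.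
    have [|M AM Mx] := sS x; first by rewrite inE eqxx.
    have [MN|NM] := Atot _ _ AM AN.
      by exists N => // y; rewrite inE => /orP[/eqP ->|/sN //]; exact: MN.
    by exists M => // y; rewrite inE => /orP[/eqP ->|/sN /NM].
  have [cN nN eN] := AP _ AN.
  have WN : W `<=` nrm N by move=> x _; exact: nN.
  have oNW : open (gen ((N : set G) `|` W) : set G).
    by apply: gen_open oW _; exact: subsetUr.
  have eNW : elem (gen ((N : set G) `|` W)).
    apply: (elem_extension_compact tG (C := W) (open_subgroup_closed oNW) cN) => //.
    - by move=> x Nx; apply: sub_gen; left.
    - by move=> x _; exact: nN.
    - by move=> x /(gen_mulP WN).
  apply: elem_sub eNW => //.
    by apply: open_subgroup_closed; apply: gen_open oW _; exact: subsetUl.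
  by apply: gen_sub => x [Wx|/sN Nx]; [right|left].
split.
- exact: closed_closure.
- move=> g _; apply: nrm_closure; apply: nrm_gen.
  apply: nrmP => x [N AN Nx]; exists N => //; have [_ nN _] := AP _ AN;
    exact/(nN _ I).
- apply: elem_sub eWS => //; first exact: closed_closure.
  apply: closure_sub_closed; last by apply: gen_sub; exact: subsetUr.
  by apply: open_subgroup_closed; apply: gen_open oW _; exact: subsetUl.
Qed.

Lemma maximal_elem_normal : exists2 R, elem_normal R &
  forall N, elem_normal N -> R `<=` N -> N `<=` R.
Proof.
have [hG _ _ _] := tG.
have P1 : elem_normal (one_subgroup G).
  split.
  - by apply: compact_closed => //; exact: compact_set1.
  - by move=> v _; apply: nrmP => x ->; rewrite /= conj1g.
  - exact: elem_trivial.
pose T := {N : subgroup G | elem_normal N}.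
pose le (M N : T) := `[< (sval M : set G) `<=` sval N >].
have [||A Atot|[R PR] Rmax] := @ZL_preorder T (exist _ _ P1) le.
- by move=> M; apply/asboolP.
- by move=> N M P /asboolP MN /asboolP NP; apply/asboolP; exact: subset_trans NP.
(* The empty chain is bounded by the trivial subgroup. *)
- have [->|/set0P A0] := eqVneq A set0; first by exists (exist _ _ P1).
  pose A' := (@sval _ _ : T -> subgroup G) @` A.
  have PN : elem_normal (closure_subgroup (gen (\bigcup_(N in A') (N : set G)))).
    apply: elem_normal_chain.
    + by have [N AN] := A0; exists (sval N), N.
    + by move=> _ [N AN <-]; exact: (svalP N).
    + move=> _ _ [M AM <-] [N AN <-].
      by have [/asboolP MN|/asboolP NM] := Atot _ _ AM AN; [left|right].
  exists (exist _ _ PN) => M AM; apply/asboolP => x Mx /=.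
  apply: subset_closure; apply: sub_gen; exists (sval M) => //.
  by exists M.
- exists R => // N PN RN; apply/asboolP.
  by apply: (Rmax (exist _ _ PN)); apply/asboolP.
Qed.

End MaximalNormal.

(** * Regularity and the conclusion *)

Section Regular.
Context (G : topologicalGroupType).
Hypothesis tG : tdlcsc G.

(** As [V] is open, neighbourhoods of 1 in the quotient lift to neighbourhoods of 1 in [G]. This
    transfers the open normaliser and the local solvability of [K] to its preimage [Kt]. *)
Lemma locally_normal_preimage (V : subgroup G) (L : normal_subgroup (subgroup_group V))
    (K : subgroup (quotient_group L)) :
  open (V : set G) -> locally_normal K -> locally_solvable (K : set (quotient_group L)) ->
  exists (Kt M : subgroup G) (d : nat),
    [/\ Kt `<=` V, forall y, Kt (sub_val y) <-> K (quotg_pi L y), open (M : set G),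
        open (nrm Kt : set G) &
        comm_set d (subgroupI Kt M) `<=` @sub_val G V @` L].
Proof.
move=> oV [_ oK] [Q [d [Q1 Qd]]]; have [hG dG lG _] := tG.
pose pi : subgroup_group V -> quotient_group L := quotg_pi L.
have piM : {morph pi : x y / x * y} by move=> x y; rewrite /pi -quotg_piM.
have ex_near (T : set (quotient_group L)) : nbhs (1 : quotient_group L) T ->
    nbhs (1 : G) [set x | exists2 y : subgroup_group V, sub_val y = x & T (pi y)].
  move=> T1; have T1' : nbhs (1 : subgroup_group V) (pi @^-1` T).
    by apply: (@quotg_pi_continuous _ L); exact: T1.
  have [V' V'1 V'T] := sub_val_nbhs T1'.
  apply: filterS2 V'1 (nbhs_subgroup oV) => x V'x Vx.
  by exists (sub_mk Vx) => //; exact: (V'T (sub_mk Vx)).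
pose S := [set x | exists2 y : subgroup_group V, sub_val y = x & K (pi y)].
have S1 : S 1 by exists 1 => //; rewrite (morph_group1 piM); exact: subgroup1.
have SM x y : S x -> S y -> S (x * y).
  move=> [a <- Ka] [b <- Kb]; exists (a * b) => //.
  by rewrite piM; exact: subgroupM.
have SV x : S x -> S x^-1.
  by move=> [a <- Ka]; exists a^-1 => //; rewrite (morph_groupV piM); exact: subgroupV.
pose Kt : subgroup G := {| subgroup1 := S1; subgroupM := SM; subgroupV := SV |}.
have KtP y : Kt (sub_val y) <-> K (pi y).
  by split=> [[z /sub_val_inj -> //]|Ky]; exists y.
have [M [oM _ MQ]] := van_dantzig hG dG lG (ex_near _ Q1).
exists Kt, M, d; split=> //.
- by move=> _ [y <- _]; exact: sub_val_in.
- apply: open_subgroupP.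
  have N1 : nbhs (1 : quotient_group L) (normalizer K).
    apply: open_nbhs_nbhs; split=> //; rewrite /normalizer /mkset.
    apply/seteqP; split=> [_ [x Kx <-]|x Kx]; first by rewrite conjg1.
    by exists x => //; rewrite conjg1.
  apply: filterS (ex_near _ N1) => _ [y <- Ny] z.
  have Vy := sub_val_in y; split=> [[a az Ka]|[a <- Ka]].
    have Vz : V z.
      rewrite -(conjgK (sub_val y) z) -az; apply: subgroup_conj; first exact: sub_val_in.
      exact: subgroupV.
    have aE : a = sub_mk Vz ^ y by apply: sub_val_inj; rewrite sub_valJ.
    exists (sub_mk Vz) => //.
    have : (K : set _) (pi (sub_mk Vz) ^ pi y) by rewrite -(morph_groupJ piM) -aE.
    by rewrite -[X in X _](Ny) => -[k Kk /conjg_inj <-].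
  exists (a ^ y) => //; rewrite (morph_groupJ piM).
  have : [set x ^ pi y | x in (K : set _)] (pi a ^ pi y) by exists (pi a).
  by rewrite Ny.
- move=> z Dz.
  pose B' := [set y : subgroup_group V | K (pi y) /\ M (sub_val y)].
  have Dz' : comm_set d (@sub_val G V @` B') z.
    by apply: comm_set_sub Dz => x [[y <- Ky] My]; exists y.
  have [y Dy <-] := comm_set_image (@sub_valM G V) Dz'.
  exists y => //; have : pi y = 1.
    apply: Qd; apply: (comm_set_morph piM) Dy => x [Kx Mx]; split=> //.
    by have [x' /sub_val_inj <-] := MQ _ Mx.
  rewrite -(morph_group1 piM) => /esym /quotg_piP.
  by rewrite invg1 mul1g.
Qed.

(** [N] is the closed subgroup generated by [R] and all conjugates of [Kt]. Finitely many elements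
    of these involve finitely many [g], and the germ [Y] from [invariant_conjugates_germ] makes
    [elem_gen_solvable] applicable. *)
Lemma elem_normal_extend (R Kt M V : subgroup G) d :
  elem_normal R -> open (V : set G) -> compact (V : set G) -> Kt `<=` V ->
  open (M : set G) -> open (nrm Kt : set G) ->
  comm_set d (subgroupI Kt M) `<=` R ->
  exists N, [/\ elem_normal N, R `<=` N & Kt `<=` N].
Proof.
move=> [cR nR eR] oV cV KV oM oN DR.
pose F := [set f | exists k g, Kt k /\ f = k ^ g].
pose B := subgroupI Kt M; pose V1 := subgroupI (nrm Kt) M.
have oV1 : open (V1 : set G) by exact: openI.
have V1B : V1 `<=` nrm B by move=> x [Nx Mx]; apply: nrmI => //; exact: nrm_self.
have eF : elem (gen (((V : set G) `|` R) `|` F)).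
  apply: (elem_gen_finite tG oV) => [|s sF]; first exact: subsetUl.
  have [l lP] : exists l : seq G, forall f, f \in s ->
      exists2 g, g \in l & exists2 k, Kt k & f = k ^ g.
    elim: s sF => [|f s IH] sF; first by exists [::].
    have [|l lP] := IH; first by move=> y ys; apply: sF; rewrite inE ys orbT.
    have [|k [g [Kk fE]]] := sF f; first by rewrite inE eqxx.
    exists (g :: l) => h; rewrite inE => /orP[/eqP ->|/lP [g' g'l kh]].
      by exists g; [rewrite inE eqxx|exists k].
    by exists g' => //; rewrite inE g'l orbT.
  have [Y [e [YV VY YR Yl]]] := invariant_conjugates_germ nR oV1 V1B DR l oV cV.
  apply: (elem_gen_solvable tG oV cV cR eR YV _ _ VY YR).
  - by move=> x _; exact: nR.
  - by move=> x _; exact: nR.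
  - move=> f /lP [g gl [k Kk ->]].
    (* For [v] near 1, [[~ v ^ g^-1, k]] lies in [Kt] because [v ^ g^-1] normalises [Kt], and in [M]
       by continuity. So [[~ v, k ^ g]] is in the conjugate of [B] by [g], hence in [Y]. *)
    have h1 := near_commg (k ^ g) (Yl g gl).
    have h2 := near_conjg g^-1 (nbhs_subgroup oN).
    have h3 := near_conjg g^-1 (near_commg k (nbhs_subgroup oM)).
    apply: filterS3 h1 h2 h3 => v h1 h2 h3; apply: h1.
    have E : [~ v, k ^ g] ^ g^-1 = [~ v ^ g^-1, k] by rewrite conjRg conjgK.
    change (B ([~ v, k ^ g] ^ g^-1)); rewrite E; split=> //.
    rewrite commgEr; apply: subgroupM => //; apply/h2; exact: subgroupV.
exists (closure_subgroup (gen ((R : set G) `|` F))).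
have sub : gen ((R : set G) `|` F) `<=` closure_subgroup (gen ((R : set G) `|` F)).
  exact: subset_closure.
split.
- split; first exact: closed_closure.
    move=> g _; apply: nrm_closure; apply: nrm_gen; apply: nrmU; first exact: nR.
    apply: nrmP => _ [k [h [Kk ->]]].
      by exists k, (h * g); rewrite conjgM.
    by exists k, (h * g^-1); rewrite conjgM.
  apply: elem_sub eF => //; first exact: closed_closure.
  apply: closure_sub_closed; last by apply: gen_sub; apply: setSU; exact: subsetUr.
  by apply: open_subgroup_closed; apply: gen_open oV _ => x Vx; left; left.
- by move=> x Rx; apply: sub; apply: sub_gen; left.
- move=> k Kk; apply: sub; apply: sub_gen; right.
  by exists k, 1; rewrite conjg1.
Qed.

End Regular.

Theorem theorem1p12 (G : topologicalGroupType) :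
  tdlcsc G -> A_regular G -> elementary G.
Proof.
move=> tG rG; have [hG dG lG _] := tG.
have [R [cR nR eR] Rmax] := maximal_elem_normal tG.
have [V [oV cV _]] := van_dantzig hG dG lG (@filterT _ _ (nbhs_filter (1 : G))).
have [VR|nVR] := pselect (V `<=` R).
  have oR : open (R : set G).
    by apply: open_subgroupP; apply: filterS (nbhs_subgroup oV).
  apply: (@elem_full G (gen [set: G])) => [x|]; first exact: sub_gen.
  apply: (elem_extension_open tG oR) => //.
  - by apply: gen_open oR _.
  - by move=> x _; exact: sub_gen.
  - by move=> x _; exact: nR.
(* Regularity is applied to the proper normal subgroup [L] of [V] formed by the elements of [V] in
   [R]. *)
exfalso; have VnR : V `<=` nrm R by move=> x _; exact: nR.
pose L := normal_sub_in VnR.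
have cL : closed (L : set (subgroup_group V)).
  by apply: preimage_closed => // x _; exact: sub_val_continuous.
have LP y : L y <-> R (sub_val y) by [].
have [|K [cK K1 lK aK]] := rG V cV oV L cL.
  move=> LT; apply: nVR => x Vx; have : [set: subgroup_group V] (sub_mk Vx) by [].
  by rewrite -LT.
have sK := locally_solvable_sub (classA_locally_solvable aK).
have [Kt [M [d [KtV KtP oM oN DL]]]] := locally_normal_preimage tG oV lK sK.
have [||N [eN RN KN]] := @elem_normal_extend G tG R Kt M V d _ oV cV KtV oM oN.
- by split.
- by apply: subset_trans DL _ => _ [y Ly <-].
(* Maximality puts [Kt] inside [R], so [K] is trivial in the quotient by [L]. *)
have KtR := subset_trans KN (Rmax N eN RN).
apply: K1; apply/seteqP; split=> [a Ka|_ ->]; last exact: subgroup1.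
have [y ya] := quotg_surj a; rewrite -ya in Ka *.
suff : quotg_pi L 1 = quotg_pi L y by move=> <-.
apply/quotg_piP; rewrite invg1 mul1g.
by apply: (KtR (sub_val y)); apply/KtP.
Qed.
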